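(* There exists an absolute constant $c>0$ such that the following holds. Let $d\leq n$ and let $X\in\mathbb{R}^{n\times d}$ be a random matrix whose rows $\mathbf{x}_1^\top,\ldots,\mathbf{x}_n^\top$ are i.i.d. random vectors. Let $\Sigma:=\mathbb{E}\left[\frac{1}{n}X^\top X\right]\in\mathbb{R}^{d\times d}$, assume that $\Sigma$ is invertible, and let $\hat{\Sigma}:=\frac{1}{n}X^\top X$. Let $m>0$ be a number such that $\mathbf{z}_i:=\Sigma^{-1/2}\mathbf{x}_i$ satisfy $\|\mathbf{z}_i\|_2\leq\sqrt{m}$ almost surely for all $i\in[n]$. Then for any $t\geq 0$, with probability at least $1-2d\exp(-ct^2)$ it holds that for all $i\in[d]$, $$\left|\lambda_i(\hat\Sigma) - \lambda_i(\Sigma)\right| \leq \lambda_i(\Sigma)\max\left(\epsilon, \epsilon^2\right), \qquad\text{where}\quad \epsilon:=t\sqrt{\frac{m}{n}}.$$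
   Context: $\lambda_i(\cdot)$ denotes the $i$-th largest eigenvalue of a symmetric matrix ($\lambda_1\geq\lambda_2\geq\dots$), $[k]=\{1,\ldots,k\}$, and $\|\cdot\|_2$ of a vector is the Euclidean norm. *)

(* Defs.v *)
From HB Require Import structures.
From mathcomp Require Export all_boot all_order all_algebra.
From mathcomp Require Export all_classical all_reals all_analysis.

Set Implicit Arguments.
Unset Strict Implicit.
Unset Printing Implicit Defensive.

Export Order.TTheory GRing.Theory Num.Theory.
Export numFieldNormedType.Exports.

Local Open Scope classical_set_scope.
Local Open Scope ring_scope.

Section Matrices.
Context {R : realType}.

(* Algebraic multiplicities are counted. The sequence is unique when it exists,
   and it exists for every symmetric A; otherwise the value is [::]. *)
Definition spectrum d (A : 'M[R]_d) : seq R :=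
  xget [::] [set s : seq R |
    sorted >=%R s /\ char_poly A = \prod_(a <- s) ('X - a%:P)].

(* The index is shifted: i : 'I_d selects the (i + 1)-th largest eigenvalue. *)
Definition eigval d (A : 'M[R]_d) (i : 'I_d) : R := (spectrum A)`_i.

Definition psdmx d (A : 'M[R]_d) : Prop :=
  A^T = A /\ forall u : 'cV[R]_d, 0 <= (u^T *m A *m u) 0 0.

(* The unique positive semidefinite square root of a positive semidefinite A;
   0 if A is not positive semidefinite. *)
Definition sqrtmx d (A : 'M[R]_d) : 'M[R]_d :=
  xget 0 [set S : 'M[R]_d | psdmx S /\ S *m S = A].

(* The library's norm `|v| on matrices is the maximum norm. *)
Definition norm2 d (v : 'cV[R]_d) : R := Num.sqrt (\sum_(j < d) v j 0 ^+ 2).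

Definition gram n d (X : 'M[R]_(n, d)) : 'M[R]_d := n%:R^-1 *: (X^T *m X).

End Matrices.

Section Probability.
Context {R : realType} {disp : measure_display} {T : measurableType disp}.
Variable P : probability T R.

Definition mutually_independent (I : finType) (disp' : measure_display)
    (T' : measurableType disp') (x : I -> {RV P >-> T'}) : Prop :=
  forall (J : {set I}) (B : I -> set T'), (forall i, measurable (B i)) ->
    P (\bigcap_(i in [set i | i \in J]) (x i @^-1` B i)) =
    (\prod_(i in J) P (x i @^-1` B i))%E.

Definition identically_distributed (I : Type) (disp' : measure_display)
    (T' : measurableType disp') (x : I -> {RV P >-> T'}) : Prop :=
  forall (i k : I) (B : set T'), measurable B ->
    distribution P (x i) B = distribution P (x k) B.

Definition mx_integrable n d (A : T -> 'M[R]_(n, d)) : Prop :=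
  forall i j, P.-integrable setT (fun w => (A w i j)%:E).

(* Meaningful only under [mx_integrable A]. *)
Definition mx_expectation n d (A : T -> 'M[R]_(n, d)) : 'M[R]_(n, d) :=
  \matrix_(i, j) fine ('E_P[fun w => A w i j])%E.

(* R^d is d.-tuple R, whose sigma-algebra (generated by the coordinates) is the
   Borel one. *)
Definition rows_mx n d (x : 'I_n -> {RV P >-> d.-tuple R}) (w : T) :
    'M[R]_(n, d) :=
  \matrix_(i, j) tnth (x i w) j.

End Probability.

(* Main.v *)
(* Whitening by Sigma^(-1/2) reduces the claim to bounding S = (1/n) sum_i z_i z_i^T - I
   in operator norm by delta = max(eps, eps^2): then (1 - delta) Sigma <= Sigma_hat <=
   (1 + delta) Sigma, and Courant-Fischer compares eigenvalues.

   The tail of S comes from Markov's inequality for tr S^(2p) with p of order t^2.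
   Write S = sum_i W_i and S_i = S - W_i, and put mu = m / n.  Independence gives
   E tr(W_i S_i^q) = 0 for all q, while for symmetric A and B one has
     2 tr((A - B)(A^N - B^N)) <= N tr((A - B)^2 (A^(N-1) + B^(N-1)))   (N odd),
   a scalar inequality summed over pairs of eigenvalues.  Taking A = S, B = S_i,
   N = 2p - 1, together with W_i^2 <= mu (z_i z_i^T + I) / n, yields
     2 E tr S^(2p) <= (2p - 1) mu (E tr S^(2p-1) + 4 E tr S^(2p-2)),
   and Young's inequality turns this into E tr S^(2p) <= d L^(2p) as soon as L and L^2
   dominate 5 (2p - 1) mu.  No matrix exponential is needed. *)
Require Import Defs.
From mathcomp Require Import measurable_realfun ring lra zify.

Set Implicit Arguments.
Unset Strict Implicit.
Unset Printing Implicit Defensive.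

Local Open Scope classical_set_scope.
Local Open Scope ring_scope.

(** * Spectral theorem for real symmetric matrices *)

Section InnerProduct.
Context {R : realType}.

(** The obstacle in E tr S^(2p) = sum_i E tr(W_i S^(2p-1)) is that W_i and S are dependent. Passing
    from S to S_i costs a difference that the odd-power inequality bounds by traces of W_i^2 against
    even powers, which are positive semidefinite, so an upper bound on W_i^2 may be inserted. As
    (z_i z_i^T + I) / n = W_i + 2 I / n, each of the two even powers leaves 2 / n times its trace;
    convexity brings tr S_i^(2p-2) back to tr S^(2p-2), and summing over i gives the factor 4.

    The bound on W_i^2 uses m >= 1, which holds for d >= 1 because d = E |z_i|^2 <= m.

    Markov's inequality is applied with L = delta / 2, which leaves d 4^(-p), and p is the integer
    part of t^2 / 64. The linear condition on L follows from delta >= eps^2 = t^2 mu and the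
    quadratic one from delta^2 >= eps^2: hence the maximum of eps and eps^2. *)

Definition dot d (u v : 'rV[R]_d) : R := (u *m v^T) 0 0.

Definition quad d (A : 'M[R]_d) (u : 'rV[R]_d) : R := dot (u *m A) u.

Lemma dotE d (u v : 'rV[R]_d) : dot u v = \sum_j u 0 j * v 0 j.
Proof. by rewrite /dot mxE; apply: eq_bigr => j _; rewrite mxE. Qed.

Lemma dotC d (u v : 'rV[R]_d) : dot u v = dot v u.
Proof. by rewrite !dotE; apply: eq_bigr => j _; rewrite mulrC. Qed.

Lemma dotDl d (u v w : 'rV[R]_d) : dot (u + v) w = dot u w + dot v w.
Proof. by rewrite /dot mulmxDl mxE. Qed.

Lemma dotDr d (u v w : 'rV[R]_d) : dot u (v + w) = dot u v + dot u w.
Proof. by rewrite dotC dotDl !(dotC u). Qed.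

Lemma dotZl d a (u v : 'rV[R]_d) : dot (a *: u) v = a * dot u v.
Proof. by rewrite /dot -scalemxAl mxE. Qed.

Lemma dotZr d a (u v : 'rV[R]_d) : dot u (a *: v) = a * dot u v.
Proof. by rewrite dotC dotZl dotC. Qed.

Lemma dotBl d (u v w : 'rV[R]_d) : dot (u - v) w = dot u w - dot v w.
Proof. by rewrite /dot mulmxBl !mxE. Qed.

Lemma dot_ge0 d (u : 'rV[R]_d) : 0 <= dot u u.
Proof. by rewrite dotE sumr_ge0// => j _; rewrite -expr2 sqr_ge0. Qed.

Lemma dot_eq0 d (u : 'rV[R]_d) : (dot u u == 0) = (u == 0).
Proof.
apply/eqP/eqP => [|->]; last by rewrite /dot mul0mx mxE.
rewrite dotE => /psumr_eq0P u0; apply/rowP => j; rewrite mxE.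
have := u0 (fun j _ => _ : 0 <= u 0 j * u 0 j) j isT => /(_ _)/eqP.
rewrite mulf_eq0 orbb => h; apply/eqP/h => k.
by rewrite -expr2 sqr_ge0.
Qed.

Lemma dot_gt0 d (u : 'rV[R]_d) : (0 < dot u u) = (u != 0).
Proof. by rewrite lt_neqAle dot_ge0 andbT eq_sym dot_eq0. Qed.

Lemma dot_mulmx d (A : 'M[R]_d) (u v : 'rV[R]_d) :
  dot (u *m A) v = dot u (v *m A^T).
Proof. by rewrite /dot trmx_mul trmxK mulmxA. Qed.

Lemma quadD d (A B : 'M[R]_d) u : quad (A + B) u = quad A u + quad B u.
Proof. by rewrite /quad mulmxDr dotDl. Qed.

Lemma quadB d (A B : 'M[R]_d) u : quad (A - B) u = quad A u - quad B u.
Proof. by rewrite /quad mulmxBr dotBl. Qed.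

Lemma quadZ d a (A : 'M[R]_d) u : quad (a *: A) u = a * quad A u.
Proof. by rewrite /quad -scalemxAr dotZl. Qed.

Lemma quad1 d (u : 'rV[R]_d) : quad 1%:M u = dot u u.
Proof. by rewrite /quad mulmx1. Qed.

Lemma quad_scale d (A : 'M[R]_d) a u : quad A (a *: u) = a ^+ 2 * quad A u.
Proof. by rewrite /quad -scalemxAl dotZl dotZr mulrA. Qed.

Lemma quad_conj d (A B : 'M[R]_d) u : quad (B *m A *m B^T) u = quad A (u *m B).
Proof. by rewrite /quad /dot trmx_mul !mulmxA. Qed.

Lemma psdmxP d (A : 'M[R]_d) :
  psdmx A <-> A^T = A /\ forall u, 0 <= quad A u.
Proof.
split=> -[sA Age0]; split=> // u.
- by have := Age0 u^T; rewrite trmxK.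
- by have := Age0 u^T; rewrite /quad /dot trmxK.
Qed.

End InnerProduct.

Section Spectral.
Context {R : realType}.

Let continuous_dot d (f g : 'rV[R]_d -> 'rV[R]_d) :
  (forall j, continuous (fun u => f u 0 j)) ->
  (forall j, continuous (fun u => g u 0 j)) ->
  continuous (fun u => dot (f u) (g u)).
Proof.
move=> cf cg; under eq_fun do rewrite dotE.
apply: (continuous_big (@add_continuous _)) => j _ u.
exact: continuousM (cf j u) (cg j u).
Qed.

Let continuous_mulmx d k (A : 'M[R]_(d, k)) j :
  continuous (fun u : 'rV[R]_d => (u *m A) 0 j).
Proof.
under eq_fun do rewrite mxE.
apply: (continuous_big (@add_continuous _)) => i _ u.
by apply: continuousM; [exact: coord_continuous|exact: cst_continuous].
Qed.

(** By compactness [quad A] attains a maximum on the unit sphere of the orthogonal complement of the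
    rows of V. Symmetry of A makes this complement invariant, so the residual [u *m A - l *: u] is
    an admissible direction; moving along it would increase the Rayleigh quotient unless the
    residual vanishes. *)
Lemma rayleigh_eigenvector d k (A : 'M[R]_d) (V : 'M[R]_(k, d)) (a : 'rV_k) :
  (k < d)%N -> A^T = A -> V *m A = diag_mx a *m V ->
  exists (u : 'rV[R]_d) (l : R), [/\ dot u u = 1, V *m u^T = 0 & u *m A = l *: u].
Proof.
move=> kd sA VA.
have [w w0 Vw] : exists2 w : 'rV[R]_d, w != 0 & w *m V^T = 0.
  have rk : (0 < \rank (kermx V^T))%N.
    by rewrite mxrank_ker subn_gt0 (leq_ltn_trans _ kd)// rank_leq_col.
  have /rowV0Pn[w /sub_kermxP wV w0] : kermx V^T != 0 by rewrite -mxrank_eq0 -lt0n.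
  by exists w.
pose K := [set u : 'rV[R]_d | dot u u = 1 /\ u *m V^T = 0].
have cdot : continuous (fun u : 'rV[R]_d => dot u u).
  by apply: continuous_dot => j; exact: coord_continuous.
have K0 : K !=set0.
  exists ((Num.sqrt (dot w w))^-1 *: w); split; last by rewrite -scalemxAl Vw scaler0.
  rewrite dotZl dotZr mulrA -expr2 exprVn sqr_sqrtr ?dot_ge0// mulVf//.
  by rewrite dot_eq0.
have cK : compact K.
  apply: bounded_closed_compact.
    exists 1; split=> // M M1 u [u1 _].
    apply: le_trans (ltW M1); rewrite [leLHS]mx_normrE; apply: bigmax_le => // -[i j] _ /=.
    rewrite ord1 -(@ler_pXn2r _ 2)// ?nnegrE//.
    rewrite expr1n real_normK ?num_real// -u1 dotE (bigD1 j)//= -expr2 lerDl.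
    by apply: sumr_ge0 => l _; rewrite -expr2 sqr_ge0.
  have -> : K = (fun u => dot u u) @^-1` [set 1] `&`
     \bigcap_(j in [set: 'I_k]) ((fun u : 'rV[R]_d => (u *m V^T) 0 j) @^-1` [set 0]).
    apply/seteqP; split=> u /=.
      by move=> [u1 uV]; split=> // j _ /=; rewrite uV mxE.
    by move=> [u1 uV]; split=> //; apply/rowP => j; rewrite [LHS](uV j I) mxE.
  apply: closedI.
    by apply: preimage_closed => //; exact: closed_eq.
  apply: closed_bigI => j _.
  by apply: preimage_closed => // u _; exact: continuous_mulmx.
have cq : {within K, continuous (quad A)}.
  apply: continuous_subspaceT; apply: continuous_dot => j; last exact: coord_continuous.
  exact: continuous_mulmx.
have [u /set_mem[u1 uV] umax] := EVT_max_rV K0 cK cq.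
pose l := quad A u.
have le_l v : v *m V^T = 0 -> quad A v <= l * dot v v.
  have [->|v0] := eqVneq v 0; first by rewrite /quad /dot !mul0mx mxE mulr0.
  move=> vV; have v1 : 0 < dot v v by rewrite dot_gt0.
  have := umax ((Num.sqrt (dot v v))^-1 *: v); rewrite quad_scale exprVn sqr_sqrtr ?dot_ge0//.
  rewrite ler_pdivrMl// mulrC; apply; rewrite inE; split; last by rewrite -scalemxAl vV scaler0.
  by rewrite dotZl dotZr mulrA -expr2 exprVn sqr_sqrtr ?dot_ge0// mulVf ?gt_eqF.
exists u, l; split=> //.
  by apply: trmx_inj; rewrite trmx_mul trmxK uV trmx0.
have [v vE] : exists v, v = u *m A - l *: u by exists (u *m A - l *: u).
have vV : v *m V^T = 0.
  rewrite vE mulmxBl -scalemxAl uV scaler0 subr0 -mulmxA.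
  have -> : A *m V^T = V^T *m diag_mx a.
    by rewrite -{1}sA -trmx_mul VA trmx_mul tr_diag_mx.
  by rewrite mulmxA uV mul0mx.
have pert (s : R) : 2 * s * dot v v <= s ^+ 2 * (l * dot v v - quad A v).
  have := le_l (u + s *: v); rewrite mulmxDl uV -scalemxAl vV scaler0 addr0.
  move=> /(_ erefl); rewrite /quad mulmxDl !(dotDl, dotDr, dotZl, dotZr) -!scalemxAl.
  rewrite !(dotDl, dotDr, dotZl, dotZr).
  have -> : dot (v *m A) u = dot (u *m A) v by rewrite dot_mulmx sA dotC.
  have uv : dot v v = dot (u *m A) v - l * dot u v by rewrite {1}vE dotBl dotZl.
  rewrite (dotC v u) u1 -/(quad A u) -/l -/(quad A v).
  by move=> h; rewrite {1}uv; lra.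
apply/eqP; rewrite -subr_eq0 -vE -dot_eq0; apply/eqP.
set x := dot v v in pert *; set C := _ - _ in pert.
have x0 : 0 <= x by exact: dot_ge0.
have C1 : 0 < `|C| + 1 by rewrite ltr_pwDr.
(* For s = x / (|C| + 1) the inequality reads 2 s x <= s^2 C <= s x, so s x <= 0 and x = 0. *)
have := pert (x / (`|C| + 1)); set y := _ / _ => hy.
have xy : x = y * (`|C| + 1) by rewrite /y divfK// gt_eqF.
have : y ^+ 2 * C <= y ^+ 2 * (`|C| + 1).
  by rewrite ler_wpM2l ?sqr_ge0// (le_trans (ler_norm _))// lerDl.
have -> : y ^+ 2 * (`|C| + 1) = y * x by rewrite xy; ring.
move=> h; have yx : y * x <= 0 by lra.
apply/eqP; rewrite eq_le x0 andbT leNgt; apply/negP => x_gt0.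
by have := mulr_gt0 (divr_gt0 x_gt0 C1) x_gt0; rewrite ltNge yx.
Qed.

Lemma spectral_partial d (A : 'M[R]_d) k : A^T = A -> (k <= d)%N ->
  exists (V : 'M[R]_(k, d)) (a : 'rV_k), V *m V^T = 1%:M /\ V *m A = diag_mx a *m V.
Proof.
move=> sA; elim: k => [_|k IH kd].
  by exists 0, 0; split; apply/matrixP => -[].
have [V [a [V1 VA]]] := IH (ltnW kd).
have [u [l [u1 Vu uA]]] := rayleigh_eigenvector kd sA VA.
rewrite -(addn1 k).
exists (col_mx V u), (row_mx a (l%:M)); split.
  rewrite tr_col_mx mul_col_row V1 Vu.
  have -> : u *m V^T = 0 by apply: trmx_inj; rewrite trmx_mul trmxK Vu trmx0.
  have -> : u *m u^T = 1%:M by rewrite [LHS]mx11_scalar -/(dot u u) u1.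
  by rewrite -scalar_mx_block.
rewrite diag_mx_row mul_block_col mul_col_mx VA uA !mul0mx addr0 add0r.
congr col_mx; rewrite (_ : diag_mx _ = l%:M) ?mul_scalar_mx//.
by apply/matrixP => i j; rewrite !ord1 !mxE eqxx.
Qed.

Theorem spectral_theorem d (A : 'M[R]_d) : A^T = A ->
  exists (V : 'M[R]_d) (a : 'rV_d), V *m V^T = 1%:M /\ A = V^T *m diag_mx a *m V.
Proof.
move=> sA; have [V [a [V1 VA]]] := spectral_partial sA (leqnn d).
exists V, a; split=> //; have V1' := mulmx1C V1.
by rewrite -mulmxA -VA mulmxA V1' mul1mx.
Qed.

End Spectral.

(** * Eigenvalues and quadratic forms *)

Section Eigenvalues.
Context {R : realType}.

Lemma char_poly_orthogonal_conj d (V D : 'M[R]_d) : V *m V^T = 1%:M ->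
  char_poly (V^T *m D *m V) = char_poly D.
Proof.
move=> V1; rewrite /char_poly.
have -> : char_poly_mx (V^T *m D *m V) =
    map_mx polyC V^T *m char_poly_mx D *m map_mx polyC V.
  rewrite /char_poly_mx !map_mxM mulmxBr mulmxBl; congr (_ - _).
  rewrite scalar_mxC -mulmxA -map_mxM.
  by rewrite (mulmx1C V1) map_mx1 mulmx1.
rewrite !det_mulmx mulrAC -det_mulmx -map_mxM (mulmx1C V1) map_mx1 det1 mul1r//.
Qed.

(** The sorted diagonal entries show that the choice defining [spectrum] is made from a nonempty
    set; unique factorization of a split polynomial identifies the chosen sequence with them up to
    order. *)
Lemma spectrum_spec d (A V : 'M[R]_d) (a : 'rV_d) :
  V *m V^T = 1%:M -> A = V^T *m diag_mx a *m V ->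
  sorted >=%R (spectrum A) /\ perm_eq (spectrum A) (codom (a 0)).
Proof.
move=> V1 AV.
have pA : char_poly A = \prod_(x <- codom (a 0)) ('X - x%:P)%R.
  rewrite AV char_poly_orthogonal_conj// char_poly_trig ?diag_mx_is_trig//.
  rewrite /codom /image_mem big_map big_enum /=; apply: eq_bigr => i _.
  by rewrite mxE eqxx.
have : [set s : seq R | sorted >=%R s /\
    char_poly A = \prod_(a <- s) ('X - a%:P)%R] (spectrum A).
  apply: (@xgetPex _ [::]); exists (sort >=%R (codom (a 0))); split.
    by apply: sort_sorted => x y; exact: le_total.
  rewrite pA; apply: perm_big; rewrite perm_sym; exact/permPl/perm_sort.
move=> [ss]; rewrite pA => ps; split=> //.
by apply: prod_XsubC_eq; rewrite -ps.
Qed.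

(** These counts spare any reordering of the eigenbasis. Since i starts at 0, they are i + 1 from
    above and d - i from below: d + 1 in total, one more than the dimension. *)
Lemma eigval_count d (A V : 'M[R]_d) (a : 'rV_d) (i : 'I_d) :
  V *m V^T = 1%:M -> A = V^T *m diag_mx a *m V ->
  (i < #|[pred j | (eigval A i <= a 0 j)%R]|)%N /\
  (d - i <= #|[pred j | (a 0 j <= eigval A i)%R]|)%N.
Proof.
move=> V1 AV; have [ss /permP ps] := spectrum_spec V1 AV.
have sz : size (spectrum A) = d.
  by have := ps predT; rewrite !count_predT size_codom card_ord.
have cE (P : pred R) : #|[pred j | P (a 0 j)]| = count P (spectrum A).
  by rewrite ps count_map -size_filter cardE enumT.
have homo := @sorted_leq_nth _ (>=%R : rel R) ge_trans ge_refl 0 _ ss.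
split.
  rewrite (cE (fun x => eigval A i <= x)) -(cat_take_drop i.+1 (spectrum A)) count_cat.
  rewrite (_ : count _ (take _ _) = i.+1) ?leq_addr//.
  have sz' : size (take i.+1 (spectrum A)) = i.+1 by rewrite size_takel// sz.
  rewrite -[RHS]sz'; apply/eqP; rewrite -all_count; apply/(all_nthP 0) => k.
  rewrite sz' => ki; rewrite nth_take//; apply: homo; rewrite ?inE ?sz//.
  by rewrite (leq_trans ki).
rewrite (cE (fun x => x <= eigval A i)) -(cat_take_drop i (spectrum A)) count_cat.
rewrite (_ : count _ (drop _ _) = (d - i)%N) ?leq_addl//.
have sz' : size (drop i (spectrum A)) = (d - i)%N by rewrite size_drop sz.
rewrite -[RHS]sz'; apply/eqP; rewrite -all_count; apply/(all_nthP 0) => k.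
rewrite sz' => ki; rewrite nth_drop; apply: (homo i (i + k)%N).
- by rewrite inE sz ltn_ord.
- by rewrite inE sz -ltn_subRL.
- exact: leq_addr.
Qed.

(** Meant for the complements of two sets of eigenvectors: being orthogonal to the discarded vectors
    of an orthonormal basis amounts to lying in the span of the kept ones. *)
Lemma orthogonal_vector d (V W : 'M[R]_d) (J L : pred 'I_d) :
  (#|J| + #|L| < d)%N ->
  exists2 u : 'rV[R]_d, u != 0 &
    (forall j, J j -> dot u (row j V) = 0) /\ (forall l, L l -> dot u (row l W) = 0).
Proof.
move=> JL.
pose U := (\sum_(j | J j) <<row j V>> + \sum_(l | L l) <<row l W>>)%MS.
have rU : (\rank U < d)%N.
  apply: leq_ltn_trans JL; apply: leq_trans (mxrank_adds_leqif _ _).1 _.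
  have bnd (Q : pred 'I_d) (M : 'M[R]_d) :
      (\rank (\sum_(j | Q j) <<row j M>>)%MS <= #|Q|)%N.
    apply: leq_trans (mxrank_sum_leqif _).1 _.
    rewrite /= -sum1_card; apply: leq_sum => j _.
    by rewrite mxrank_gen rank_leq_row.
  by apply: leq_add.
have /rowV0Pn[u /sub_kermxP uU u0] : kermx U^T != 0.
  by rewrite -mxrank_eq0 mxrank_ker mxrank_tr -lt0n subn_gt0.
have orth (v : 'rV[R]_d) : (v <= U)%MS -> dot u v = 0.
  by move=> /submxP[D ->]; rewrite /dot trmx_mul mulmxA uU mul0mx mxE.
exists u => //; split=> j Pj; apply: orth; rewrite -(genmxE (row j _)).
  by apply: submx_trans (addsmxSl _ _); apply: (sumsmx_sup j).
by apply: submx_trans (addsmxSr _ _); apply: (sumsmx_sup j).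
Qed.

Lemma quad_diag d (A V : 'M[R]_d) (a : 'rV_d) u :
  A = V^T *m diag_mx a *m V ->
  quad A u = \sum_j a 0 j * dot u (row j V) ^+ 2.
Proof.
move=> ->; rewrite -{2}(trmxK V) quad_conj /quad dotE; apply: eq_bigr => j _.
rewrite mul_mx_diag !mxE.
have -> : dot u (row j V) = \sum_k u 0 k * V^T k j.
  by rewrite dotE; apply: eq_bigr => k _; rewrite !mxE.
by rewrite expr2 mulrA mulrAC mulrC mulrA.
Qed.

Lemma dot_orthogonal d (V : 'M[R]_d) u : V *m V^T = 1%:M ->
  dot u u = \sum_j dot u (row j V) ^+ 2.
Proof.
move=> V1; rewrite -quad1 (@quad_diag _ _ V (const_mx 1)).
  by apply: eq_bigr => j _; rewrite mxE mul1r.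
by rewrite diag_const_mx mulmx1 mulmx1C.
Qed.

(* Courant-Fischer in the form of a dimension count: the span of the top i + 1
   eigenvectors of A meets the span of the bottom d - i eigenvectors of B. *)
Lemma eigval_crossing d (A B : 'M[R]_d) (i : 'I_d) : A^T = A -> B^T = B ->
  exists2 u : 'rV[R]_d, u != 0 &
    eigval A i * dot u u <= quad A u /\ quad B u <= eigval B i * dot u u.
Proof.
move=> sA sB; have [V [a [V1 AV]]] := spectral_theorem sA.
have [W [b [W1 BW]]] := spectral_theorem sB.
have [cA _] := eigval_count i V1 AV; have [_ cB] := eigval_count i W1 BW.
pose J := [pred j | eigval A i <= a 0 j]; pose L := [pred l | b 0 l <= eigval B i].
have [|u u0 [uJ uL]] := @orthogonal_vector d V W (predC J) (predC L).
  have := cardC J; have := cardC L; rewrite card_ord -/J -/L in cA cB *.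
  move: cA cB (ltn_ord i).
  move: #|J| #|L| #|predC J| #|predC L| => w x y z; lia.
exists u => //; rewrite (quad_diag u AV) (quad_diag u BW); split.
  rewrite (dot_orthogonal u V1) mulr_sumr; apply: ler_sum => j _.
  have [Jj|Jj] := boolP (J j); last by rewrite uJ ?expr0n ?mulr0.
  by rewrite ler_wpM2r ?sqr_ge0.
rewrite (dot_orthogonal u W1) mulr_sumr; apply: ler_sum => j _.
have [Lj|Lj] := boolP (L j); last by rewrite uL ?expr0n ?mulr0.
by rewrite ler_wpM2r ?sqr_ge0.
Qed.

(** One form serves two comparisons: s = 0 gives the relative bound against Sigma, r = 1 gives
    Weyl's inequality. *)
Lemma eigval_le_affine d (A B : 'M[R]_d) (i : 'I_d) (r s : R) :
  A^T = A -> B^T = B -> 0 <= r ->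
  (forall u, quad A u <= r * quad B u + s * dot u u) ->
  eigval A i <= r * eigval B i + s.
Proof.
move=> sA sB r0 AB; have [u u0 [Au Bu]] := eigval_crossing i sA sB.
rewrite -(@ler_pM2r _ (dot u u)) ?dot_gt0// mulrDl -mulrA.
by rewrite (le_trans Au)// (le_trans (AB u))// lerD2r ler_wpM2l.
Qed.

(** Not a rearrangement of the upper bound, since dividing by r would exclude r = 0, the case behind
    [eigval_ge0]. *)
Lemma eigval_affine_le d (A B : 'M[R]_d) (i : 'I_d) (r s : R) :
  A^T = A -> B^T = B -> 0 <= r ->
  (forall u, r * quad A u + s * dot u u <= quad B u) ->
  r * eigval A i + s <= eigval B i.
Proof.
move=> sA sB r0 AB; have [u u0 [Au Bu]] := eigval_crossing i sA sB.
rewrite -(@ler_pM2r _ (dot u u)) ?dot_gt0// mulrDl -mulrA.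
by apply: le_trans Bu; apply: le_trans (AB u); rewrite lerD2r ler_wpM2l.
Qed.

Lemma eigval_ge0 d (A : 'M[R]_d) (i : 'I_d) : psdmx A -> 0 <= eigval A i.
Proof.
move=> /psdmxP[sA A0].
have := @eigval_affine_le _ A A i 0 0 sA sA (lexx _).
by rewrite mul0r addr0; apply=> u; rewrite !mul0r addr0.
Qed.

Lemma dot_rowE d (V : 'M[R]_d) j k : V *m V^T = 1%:M ->
  dot (row j V) (row k V) = (j == k)%:R.
Proof.
move=> /(congr1 (fun M : 'M[R]_d => M j k)); rewrite dotE !mxE => <-.
by apply: eq_bigr => l _; rewrite !mxE.
Qed.

Lemma sqrtmxP d (A : 'M[R]_d) : psdmx A ->
  psdmx (sqrtmx A) /\ sqrtmx A *m sqrtmx A = A.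
Proof.
move=> pA; apply: (@xgetPex _ 0 [set S : 'M[R]_d | psdmx S /\ S *m S = A]).
have [sA A0] := (psdmxP A).1 pA; have [V [a [V1 AV]]] := spectral_theorem sA.
have a0 j : 0 <= a 0 j.
  have := A0 (row j V); rewrite (quad_diag _ AV) (bigD1 j)//= big1.
    by rewrite addr0 dot_rowE// eqxx expr1n mulr1.
  by move=> k kj; rewrite dot_rowE// eq_sym (negbTE kj) expr0n mulr0.
pose b : 'rV[R]_d := \row_j Num.sqrt (a 0 j).
exists (V^T *m diag_mx b *m V); split.
  apply/psdmxP; split; first by rewrite !trmx_mul tr_diag_mx trmxK mulmxA.
  move=> u; rewrite (quad_diag u erefl) sumr_ge0// => j _.
  by rewrite mulr_ge0 ?sqr_ge0// mxE sqrtr_ge0.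
rewrite !mulmxA -(mulmxA _ V) V1 mulmx1 -(mulmxA V^T) mulmx_diag AV.
congr (_ *m diag_mx _ *m _); apply/rowP => j.
by rewrite !mxE -expr2 sqr_sqrtr.
Qed.

End Eigenvalues.

(** * Trace inequalities *)

Section TraceInequalities.
Context {R : realType}.

Lemma expmx_spectral d (A V : 'M[R]_d) (a : 'rV_d) k : V *m V^T = 1%:M ->
  A = V^T *m diag_mx a *m V ->
  A ^+ k = V^T *m diag_mx (\row_j a 0 j ^+ k) *m V.
Proof.
move=> V1 AV; elim: k => [|k IH].
  rewrite expr0 (_ : \row_j _ = const_mx 1); last by apply/rowP => j; rewrite !mxE expr0.
  by rewrite diag_const_mx mulmx1 mulmx1C.
rewrite exprSr IH {1}AV -mulmxE !mulmxA -(mulmxA _ V) V1 mulmx1.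
rewrite -(mulmxA V^T) mulmx_diag; congr (_ *m diag_mx _ *m _).
by apply/rowP => j; rewrite !mxE exprSr.
Qed.

Lemma tr_expmx_spectral d (A V : 'M[R]_d) (a : 'rV_d) k : V *m V^T = 1%:M ->
  A = V^T *m diag_mx a *m V -> \tr (A ^+ k) = \sum_j a 0 j ^+ k.
Proof.
move=> V1 AV; rewrite (expmx_spectral k V1 AV) mxtrace_mulC mulmxA V1 mul1mx.
by rewrite mxtrace_diag; apply: eq_bigr => j _; rewrite mxE.
Qed.

Lemma trmx_expmx d (A : 'M[R]_d) k : A^T = A -> (A ^+ k)^T = A ^+ k.
Proof.
move=> sA; elim: k => [|k IH]; first by rewrite expr0 trmx1.
by rewrite {1}exprSr exprS -!mulmxE trmx_mul IH sA.
Qed.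

(* The weights are the squared inner products of the eigenvectors of A and B;
   they reduce trace inequalities for the noncommuting A and B to scalar ones. *)
Lemma trace_two_powers d (A B : 'M[R]_d) : A^T = A -> B^T = B ->
  exists (a b : 'rV[R]_d) (w : 'M[R]_d), (forall i j, 0 <= w i j) /\
    forall q r, \tr (A ^+ q *m B ^+ r) = \sum_i \sum_j w i j * (a 0 i ^+ q * b 0 j ^+ r).
Proof.
move=> sA sB; have [V [a [V1 AV]]] := spectral_theorem sA.
have [W [b [W1 BW]]] := spectral_theorem sB.
pose M := V *m W^T.
exists a, b, (\matrix_(i, j) M i j ^+ 2); split=> [i j|q r]; first by rewrite mxE sqr_ge0.
rewrite (expmx_spectral q V1 AV) (expmx_spectral r W1 BW).
rewrite -!mulmxA mxtrace_mulC -!mulmxA.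
have -> : W *m V^T = M^T by rewrite trmx_mul trmxK.
rewrite (mulmxA V) -/M mul_diag_mx /mxtrace; apply: eq_bigr => i _.
rewrite !mxE mulr_sumr; apply: eq_bigr => j _.
by rewrite mul_diag_mx !mxE; ring.
Qed.

(** After factoring (a - b)^2 out, the geometric sum is symmetrized under i -> 2k - i. Each pair
    satisfies x^p y^i + x^i y^p <= x^(p+i) + y^(p+i) for x = |a|, y = |b|, because x^p - y^p and x^i
    - y^i have the same sign. *)
Lemma sub_pow_odd_le (a b : R) k :
  2 * ((a - b) * (a ^+ k.*2.+1 - b ^+ k.*2.+1)) <=
  k.*2.+1%:R * ((a - b) ^+ 2 * (a ^+ k.*2 + b ^+ k.*2)).
Proof.
suff key : 2 * (\sum_(i < k.*2.+1) a ^+ (k.*2 - i) * b ^+ i) <=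
    k.*2.+1%:R * (a ^+ k.*2 + b ^+ k.*2).
  have -> : a ^+ k.*2.+1 - b ^+ k.*2.+1 =
      (a - b) * \sum_(i < k.*2.+1) a ^+ (k.*2 - i) * b ^+ i.
    by rewrite subrXX.
  by rewrite (mulrA (a - b)) -expr2 mulrCA (mulrCA _ (_ ^+ 2)) ler_wpM2l ?sqr_ge0.
rewrite [leRHS]mulr_natl.
have -> : 2 * (\sum_(i < k.*2.+1) a ^+ (k.*2 - i) * b ^+ i) =
    \sum_(i < k.*2.+1) (a ^+ (k.*2 - i) * b ^+ i + a ^+ i * b ^+ (k.*2 - i)).
  rewrite big_split/= mulr_natl mulr2n; congr (_ + _).
  rewrite (reindex_inj rev_ord_inj)/=; apply: eq_bigr => i _.
  by rewrite subSS subKn// -ltnS.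
have -> : (a ^+ k.*2 + b ^+ k.*2) *+ k.*2.+1 =
    \sum_(i < k.*2.+1) (a ^+ k.*2 + b ^+ k.*2) by rewrite sumr_const card_ord.
apply: ler_sum => i _; have ik : (i <= k.*2)%N by rewrite -ltnS.
have nrm (x : R) : x ^+ k.*2 = `|x| ^+ k.*2.
  by rewrite -normrX ger0_norm// exprn_even_ge0// odd_double.
rewrite (nrm a) (nrm b); move: (nat_of_ord i) ik => {}i /subnK <-.
move: (k.*2 - i)%N => p; rewrite addnK !exprD.
apply: (@le_trans _ _ (`|a| ^+ p * `|b| ^+ i + `|a| ^+ i * `|b| ^+ p)).
  by rewrite lerD// -!normrX -normrM ler_norm.
set x := `|a|; set y := `|b|.
have x0 : 0 <= x by rewrite /x. have y0 : 0 <= y by rewrite /y.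
suff : 0 <= (x ^+ p - y ^+ p) * (x ^+ i - y ^+ i) by lra.
case: (leP x y) => xy.
  by rewrite mulr_le0// subr_le0 lerXn2r.
by rewrite mulr_ge0// subr_ge0 lerXn2r// ltW.
Qed.

(** The tangent line of x^(k+1) at y. The induction multiplies the previous case by y and adds
    (x^(k+1) - y^(k+1)) (x - y) >= 0. *)
Lemma pow_tangent_ge0 (x y : R) k : 0 <= x -> 0 <= y ->
  k.+1%:R * (x * y ^+ k) <= x ^+ k.+1 + k%:R * y ^+ k.+1.
Proof.
move=> x0 y0; elim: k => [|k IH]; first by rewrite !mul1r mul0r expr0 addr0 mulr1.
have : 0 <= (x ^+ k.+1 - y ^+ k.+1) * (x - y).
  case: (leP x y) => xy; first by rewrite mulr_le0// subr_le0// lerXn2r.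
  by rewrite mulr_ge0// subr_ge0 ?lerXn2r// ltW.
have := ler_wpM2r y0 IH.
rewrite -(natr1 k.+1) -(natr1 k) !exprS; set X := x ^+ k; set Y := y ^+ k.
by move=> h1 h2; nra.
Qed.

Lemma pow_even_tangent (a b : R) k :
  b ^+ k.*2.+2 + k.*2.+2%:R * ((a - b) * b ^+ k.*2.+1) <= a ^+ k.*2.+2.
Proof.
have := @pow_tangent_ge0 `|a| `|b| k.*2.+1 (normr_ge0 _) (normr_ge0 _).
have nrm (x : R) : `|x| ^+ k.*2.+2 = x ^+ k.*2.+2.
  by rewrite -normrX ger0_norm// exprn_even_ge0//= negbK odd_double.
rewrite !nrm.
have : a * b ^+ k.*2.+1 <= `|a| * `|b| ^+ k.*2.+1 by rewrite -normrX -normrM ler_norm.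
have : 0 <= k.*2.+2%:R :> R by [].
rewrite mulrBl -exprS -(natr1 k.*2.+1).
by move=> h0 h1 h2; have := ler_wpM2l h0 h1; lra.
Qed.

(** By cyclicity the trace is that of A^k P A^k, a sum of values of the form P at the rows of
    A^k. *)
Lemma tr_psd_even d (P A : 'M[R]_d) k : A^T = A -> psdmx P ->
  0 <= \tr (P *m A ^+ k.*2).
Proof.
move=> sA /psdmxP[_ P0].
rewrite -addnn exprD -mulmxE mulmxA mxtrace_mulC mulmxA; apply: sumr_ge0 => i _.
have := P0 (row i (A ^+ k)); congr (0 <= _); rewrite /quad dotE mxE.
by apply: eq_bigr => j _; rewrite -row_mul -{4}(trmx_expmx k sA) !mxE.
Qed.

Section TwoMatrices.
Variables (d : nat) (A B : 'M[R]_d).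
Hypotheses (sA : A^T = A) (sB : B^T = B).

(** Once both sides of a trace inequality are written as [pairing] with the same nonnegative
    weights, it suffices to compare the integrands F pointwise. *)
Let pairing (a b : 'rV[R]_d) (w : 'M[R]_d) (F : R -> R -> R) :=
  \sum_i \sum_j w i j * F (a 0 i) (b 0 j).

Let pairingD a b w F G :
  pairing a b w F + pairing a b w G = pairing a b w (fun x y => F x y + G x y).
Proof.
rewrite /pairing -big_split; apply: eq_bigr => i _; rewrite -big_split.
by apply: eq_bigr => j _; rewrite mulrDr.
Qed.

Let pairingZ a b w c F : c * pairing a b w F = pairing a b w (fun x y => c * F x y).
Proof.
rewrite /pairing mulr_sumr; apply: eq_bigr => i _; rewrite mulr_sumr.
by apply: eq_bigr => j _; rewrite mulrCA.
Qed.

Let pairingN a b w F : - pairing a b w F = pairing a b w (fun x y => - F x y).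
Proof.
rewrite -mulN1r pairingZ; congr (pairing a b w _).
by apply/funext => x; apply/funext => y; rewrite mulN1r.
Qed.

Let pairing_le a b (w : 'M[R]_d) (F G : R -> R -> R) : (forall i j, 0 <= w i j) ->
  (forall x y, F x y <= G x y) -> pairing a b w F <= pairing a b w G.
Proof.
move=> w0 FG; apply: ler_sum => i _; apply: ler_sum => j _.
by rewrite ler_wpM2l.
Qed.

Lemma tr_sub_pow_odd_le k :
  2 * \tr ((A - B) *m (A ^+ k.*2.+1 - B ^+ k.*2.+1)) <=
  k.*2.+1%:R * (\tr ((A - B) ^+ 2 *m A ^+ k.*2) + \tr ((A - B) ^+ 2 *m B ^+ k.*2)).
Proof.
have [a [b [w [w0 wE]]]] := trace_two_powers sA sB.
pose T q r := pairing a b w (fun x y => x ^+ q * y ^+ r).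
have TE q r : \tr (A ^+ q *m B ^+ r) = T q r by exact: wE.
have trC (X Y : 'M[R]_d) : \tr (X * Y) = \tr (Y * X) by exact: mxtrace_mulC.
(* Every product in the expansions has at most one block of A's and one of B's up to cyclic
   rotation, so all traces become values of T. *)
have -> : \tr ((A - B) *m (A ^+ k.*2.+1 - B ^+ k.*2.+1)) =
    T k.*2.+2 0%N - T k.*2.+1 1%N - (T 1%N k.*2.+1 - T 0%N k.*2.+2).
  rewrite -!TE !mulmxE !expr0 !expr1 mulr1 mul1r mulrBr !mulrBl !raddfB/=.
  by rewrite (trC B (A ^+ _)) -!exprS; ring.
have -> n : \tr ((A - B) ^+ 2 *m A ^+ n) = T n.+2 0%N - T n.+1 1%N - (T n.+1 1%N - T n 2).
  rewrite -!TE !mulmxE !expr0 !expr1 mulr1 expr2 mulrBr !mulrBl !raddfB/=.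
  rewrite -!mulrA (_ : \tr (A * (B * A ^+ n)) = \tr (A ^+ n.+1 * B)); last first.
    by rewrite trC -mulrA -exprSr trC.
  rewrite (_ : \tr (B * (A * A ^+ n)) = \tr (A ^+ n.+1 * B)); last by rewrite -exprS trC.
  rewrite (_ : \tr (B * (B * A ^+ n)) = \tr (A ^+ n * (B * B))); last by rewrite mulrA trC.
  by rewrite -!exprS -expr2; ring.
have -> n : \tr ((A - B) ^+ 2 *m B ^+ n) = T 2 n - T 1%N n.+1 - (T 1%N n.+1 - T 0%N n.+2).
  rewrite -!TE !mulmxE !expr0 !expr1 mul1r expr2 mulrBr !mulrBl !raddfB/=.
  rewrite -!mulrA (_ : \tr (B * (A * B ^+ n)) = \tr (A * B ^+ n.+1)); last first.
    by rewrite trC -mulrA -exprSr.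
  by rewrite -!exprS mulrA -expr2; ring.
rewrite /T !(pairingN, pairingD, pairingZ); apply: pairing_le => // x y.
have := sub_pow_odd_le x y k; congr (_ <= _); rewrite !exprS !expr0; ring.
Qed.

(** Klein's inequality for the convex function x^(2k+2). *)
Lemma tr_pow_even_tangent k :
  \tr (B ^+ k.*2.+2) + k.*2.+2%:R * \tr ((A - B) *m B ^+ k.*2.+1) <= \tr (A ^+ k.*2.+2).
Proof.
have [a [b [w [w0 wE]]]] := trace_two_powers sA sB.
pose T q r := pairing a b w (fun x y => x ^+ q * y ^+ r).
have TE q r : \tr (A ^+ q *m B ^+ r) = T q r by exact: wE.
have -> : \tr ((A - B) *m B ^+ k.*2.+1) = T 1%N k.*2.+1 - T 0%N k.*2.+2.
  by rewrite -!TE mulmxBl raddfB/= expr1 expr0 mul1mx (exprS B k.*2.+1).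
have -> : \tr (B ^+ k.*2.+2) = T 0%N k.*2.+2 by rewrite -TE expr0 mul1mx.
have -> : \tr (A ^+ k.*2.+2) = T k.*2.+2 0%N by rewrite -TE expr0 mulmx1.
rewrite /T !(pairingN, pairingD, pairingZ); apply: pairing_le => // x y.
have := pow_even_tangent x y k; congr (_ <= _); rewrite !exprS !expr0; ring.
Qed.

End TwoMatrices.
End TraceInequalities.

(** * Power traces and rank-one terms *)

Section PowerTraces.
Context {R : realType}.

Lemma quad_le_of_trace d (A : 'M[R]_d) (delta : R) k : A^T = A -> 0 <= delta ->
  \tr (A ^+ k.*2.+2) <= delta ^+ k.*2.+2 ->
  forall u, `|quad A u| <= delta * dot u u.
Proof.
move=> sA d0; have [V [a [V1 AV]]] := spectral_theorem sA.
rewrite (tr_expmx_spectral _ V1 AV) => trd u.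
have even_ge0 (x : R) : 0 <= x ^+ k.*2.+2.
  by rewrite exprn_even_ge0//= negbK odd_double.
have a_le j : `|a 0 j| <= delta.
  rewrite -(@ler_pXn2r _ k.*2.+2) ?nnegrE// -normrX ger0_norm//.
  by apply: le_trans trd; rewrite (bigD1 j)//= lerDl sumr_ge0.
rewrite (quad_diag u AV) (dot_orthogonal u V1) mulr_sumr.
apply: le_trans (ler_norm_sum _ _ _) _; apply: ler_sum => j _.
by rewrite normrM (@ger0_norm _ (_ ^+ 2)) ?sqr_ge0// ler_wpM2r ?sqr_ge0.
Qed.

(** With x = |s|, compare x and L. If L <= x, then 2cx <= x^2 / 5 and 8c <= 4 x^2 / 5, so the left
    side is at most s^(2k+2); if x < L, the same split bounds it by L^(2k+2). The constant is 10 = 2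
    (1 + 4). *)
Lemma young_pow (s c L : R) k : 0 <= c -> 0 <= L -> 10 * c <= L -> 10 * c <= L ^+ 2 ->
  2 * (c * (s ^+ k.*2.+1 + 4 * s ^+ k.*2)) <= s ^+ k.*2.+2 + L ^+ k.*2.+2.
Proof.
move=> c0 L0 cL cL2.
have sq (x : R) : x ^+ k.*2 = `|x| ^+ k.*2.
  by rewrite -normrX ger0_norm// exprn_even_ge0// odd_double.
have -> : s ^+ k.*2.+2 = `|s| ^+ 2 * `|s| ^+ k.*2.
  by rewrite !exprS expr0 mulr1 mulrA -sq -!expr2 real_normK ?num_real.
have -> : L ^+ k.*2.+2 = L ^+ 2 * L ^+ k.*2 by rewrite -exprD.
have -> : s ^+ k.*2.+1 + 4 * s ^+ k.*2 = `|s| ^+ k.*2 * (s + 4).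
  by rewrite exprSr sq; ring.
set x := `|s|; set y := x ^+ k.*2; set z := L ^+ k.*2.
have x0 : 0 <= x by exact: normr_ge0.
have y0 : 0 <= y by rewrite exprn_ge0.
have z0 : 0 <= z by rewrite exprn_ge0.
have sx : s <= x by exact: ler_norm.
have h : 2 * (c * (y * (s + 4))) <= 2 * (c * (x + 4)) * y.
  by rewrite -mulrA ler_wpM2l// -mulrA ler_wpM2l// mulrC ler_wpM2r// lerD2r.
suff : 2 * (c * (x + 4)) * y <= x ^+ 2 * y + L ^+ 2 * z by lra.
have [Lx|xL] := leP L x.
  have : 2 * (c * (x + 4)) <= x ^+ 2 by nra.
  move=> /(ler_wpM2r y0) h1; have := sqr_ge0 L; nra.
have yz : y <= z by rewrite lerXn2r// ltW.
have : 2 * (c * (x + 4)) <= L ^+ 2 by nra.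
have c1 : 0 <= 2 * (c * (x + 4)) by rewrite !mulr_ge0// addr_ge0.
by have := sqr_ge0 x; nra.
Qed.

Lemma tr_young d (A : 'M[R]_d) (c L : R) k : A^T = A ->
  0 <= c -> 0 <= L -> 10 * c <= L -> 10 * c <= L ^+ 2 ->
  2 * (c * (\tr (A ^+ k.*2.+1) + 4 * \tr (A ^+ k.*2))) <=
  \tr (A ^+ k.*2.+2) + d%:R * L ^+ k.*2.+2.
Proof.
move=> sA c0 L0 cL cL2; have [V [a [V1 AV]]] := spectral_theorem sA.
rewrite !(tr_expmx_spectral _ V1 AV).
have -> : d%:R * L ^+ k.*2.+2 = \sum_(j < d) L ^+ k.*2.+2.
  by rewrite sumr_const card_ord mulr_natl.
rewrite mulr_sumr -!big_split/= !mulr_sumr; apply: ler_sum => j _.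
exact: young_pow.
Qed.

Lemma trmx_rank_one d (z : 'rV[R]_d) : (z^T *m z)^T = z^T *m z.
Proof. by rewrite trmx_mul trmxK. Qed.

Lemma quad_rank_one d (z u : 'rV[R]_d) : quad (z^T *m z) u = dot u z ^+ 2.
Proof.
by rewrite /quad mulmxA [u *m z^T]mx11_scalar mul_scalar_mx dotZl (dotC z) expr2.
Qed.

(** With Y = z^T z one has Y^2 = |z|^2 Y, and the difference equals n^(-2) ((m - |z|^2 + 2) Y + (m -
    1) I), whose two coefficients are nonnegative. *)
Lemma psdmx_sqr_le d n (z : 'rV[R]_d) (m : R) : (0 < n)%N -> 1 <= m ->
  dot z z <= m ->
  psdmx ((m / n%:R) *: (n%:R^-1 *: (z^T *m z) + n%:R^-1 *: 1%:M)
         - (n%:R^-1 *: (z^T *m z) - n%:R^-1 *: 1%:M) ^+ 2).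
Proof.
move=> n0 m1 zm; set q : R := n%:R^-1; set Y := z^T *m z.
have q0 : 0 <= q by rewrite invr_ge0.
have YY : Y *m Y = dot z z *: Y.
  by rewrite /Y mulmxA -(mulmxA z^T) [z *m z^T]mx11_scalar -/(dot z z) mul_mx_scalar scalemxAl.
have -> : (m / n%:R) *: (q *: Y + q *: 1%:M) - (q *: Y - q *: 1%:M) ^+ 2 =
   q ^+ 2 *: ((m - dot z z + 2) *: Y + (m - 1) *: 1%:M).
  rewrite -/q expr2 -mulmxE mulmxBr !mulmxBl -!scalemxAl -!scalemxAr YY.
  rewrite !mul1mx !mulmx1.
  by apply/matrixP => i j; rewrite !mxE; ring.
apply/psdmxP; split.
  by rewrite linearZ/= linearD/= !linearZ/= trmx_rank_one trmx1.
move=> u; rewrite quadZ quadD !quadZ quad1 mulr_ge0 ?sqr_ge0// addr_ge0// mulr_ge0 ?dot_ge0//.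
- lra.
- by rewrite quad_rank_one sqr_ge0.
- lra.
Qed.

End PowerTraces.

(** * The leave-one-out inequality *)

Section CenteredSum.
Context {R : realType}.
Variables (n d : nat) (z : 'I_n -> 'rV[R]_d) (m : R).
Hypotheses (n_gt0 : (0 < n)%N) (m1 : 1 <= m) (zm : forall i, dot (z i) (z i) <= m).

Let W i : 'M[R]_d := n%:R^-1 *: ((z i)^T *m z i) - n%:R^-1 *: 1%:M.
Let S : 'M[R]_d := \sum_i W i.
Let S' i : 'M[R]_d := \sum_(j | j != i) W j.
Let mu : R := m / n%:R.

Let sW i : (W i)^T = W i.
Proof. by rewrite /W linearB/= !linearZ/= trmx_rank_one trmx1. Qed.

Let sS : S^T = S.
Proof. by rewrite /S linear_sum/=; apply: eq_bigr => i _. Qed.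

Let sS' i : (S' i)^T = S' i.
Proof. by rewrite /S' linear_sum/=; apply: eq_bigr => j _. Qed.

Let SS' i : S - S' i = W i.
Proof. by rewrite /S (bigD1 i)//= addrK. Qed.

(** The upper bound on [W i ^+ 2] is rewritten through [W i] itself: for A = S the traces then sum
    over i to a power trace of S, and for A = [S' i] they have mean zero. *)
Let tr_sqr_le (A : 'M[R]_d) i k : A^T = A ->
  \tr (W i ^+ 2 *m A ^+ k.*2) <=
  mu * (\tr (W i *m A ^+ k.*2) + 2 / n%:R * \tr (A ^+ k.*2)).
Proof.
move=> sA; have := tr_psd_even k sA (psdmx_sqr_le n_gt0 m1 (zm i)).
rewrite mulmxBl raddfB/= subr_ge0 -/(W i); congr (_ <= _).
rewrite -scalemxAl linearZ/= -/mu; congr (_ * _).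
have -> : n%:R^-1 *: ((z i)^T *m z i) + n%:R^-1 *: 1%:M = W i + (2 / n%:R) *: 1%:M.
  by apply/matrixP => a b; rewrite !mxE; ring.
by rewrite mulmxDl linearD/= -scalemxAl linearZ/= mul1mx.
Qed.

(* The terms tr (W i * S' i ^ q) have mean zero when the z i are independent
   and isotropic, so that only d * L ^ (2k + 2) survives in expectation. *)
Lemma tr_centered_sum_le (L : R) k : 0 <= L ->
  5 * (k.*2.+1%:R * mu) <= L -> 5 * (k.*2.+1%:R * mu) <= L ^+ 2 ->
  \tr (S ^+ k.*2.+2) <= d%:R * L ^+ k.*2.+2 +
    \sum_i (2 * \tr (W i *m S' i ^+ k.*2.+1) +
      (k.*2.+1%:R * mu) * \tr (W i *m S' i ^+ k.*2) +
      - (k.*2.+1%:R * mu * (2 / n%:R) * k.*2%:R) * \tr (W i *m S' i ^+ k.*2.-1)).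
Proof.
move=> L0 kL kL2.
have tangent i : \tr (S' i ^+ k.*2) + k.*2%:R * \tr (W i *m S' i ^+ k.*2.-1) <=
    \tr (S ^+ k.*2).
  (* For k = 0 the exponent [k.*2.-1] truncates to 0, harmlessly because its coefficient [k.*2%:R]
     is 0. *)
  case: {kL kL2} k => [|k]; first by rewrite !expr0 mul0r addr0.
  by rewrite -(SS' i); exact: tr_pow_even_tangent.
set c := k.*2.+1%:R * mu in kL kL2 *.
have mu0 : 0 <= mu by rewrite divr_ge0// (le_trans _ m1).
have c0 : 0 <= c by rewrite mulr_ge0.
have step i : 2 * \tr (W i *m S ^+ k.*2.+1) <=
    c * (\tr (W i *m S ^+ k.*2) + 4 / n%:R * \tr (S ^+ k.*2)) +
    (2 * \tr (W i *m S' i ^+ k.*2.+1) + c * \tr (W i *m S' i ^+ k.*2) +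
      - (c * (2 / n%:R) * k.*2%:R) * \tr (W i *m S' i ^+ k.*2.-1)).
  have := tr_sub_pow_odd_le sS (sS' i) k; rewrite SS' mulmxBr linearB/=.
  have /(ler_wpM2l (ler0n R k.*2.+1)) := lerD (tr_sqr_le i k sS) (tr_sqr_le i k (sS' i)).
  have q0 : 0 <= c * (2 / n%:R) by rewrite mulr_ge0// divr_ge0.
  have := ler_wpM2l q0 (tangent i); rewrite /c => h1 h2 h3; lra.
have sumW q : \tr (S ^+ q.+1) = \sum_i \tr (W i *m S ^+ q).
  by rewrite exprS -mulmxE {1}/S mulmx_suml linear_sum.
have := @ler_sum R 'I_n (index_enum _) xpredT _ _ (fun i _ => step i).
rewrite -mulr_sumr -sumW big_split/= -mulr_sumr big_split/= -sumW.
rewrite sumr_const -[_ *+ #|_|]mulr_natl card_ord.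
have -> : n%:R * (4 / n%:R * \tr (S ^+ k.*2)) = 4 * \tr (S ^+ k.*2).
  by rewrite mulrA mulrCA divff ?mulr1// pnatr_eq0 -lt0n.
(* Using c / 2 turns the constant 10 of [tr_young] into 5. The trace of S^(2k+2) on its right side
   is absorbed by one of the two copies on the left of the summed inequality. *)
have := @tr_young _ _ _ (c / 2) L k sS; set Z := \sum_i (_ + _) => h1 h2.
have := h1 (_ : 0 <= c / 2) L0; lra.
Qed.

End CenteredSum.

(** * Bounded random variables and independence *)

Section FunctionAlgebra.
Context {R : realType} {T : Type}.
(** Q will be [bounded_measurable] or [free_of x i]: closure under sums and products passes from the
    entries of a matrix to entries of its powers. *)
Variable Q : (T -> R) -> Prop.
Hypothesis Q_cst : forall c, Q (fun=> c).
Hypothesis QD : forall f g, Q f -> Q g -> Q (fun w => f w + g w).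
Hypothesis QM : forall f g, Q f -> Q g -> Q (fun w => f w * g w).

Lemma algebra_sum I (s : seq I) (p : pred I) (f : I -> T -> R) :
  (forall j, p j -> Q (f j)) -> Q (fun w => \sum_(j <- s | p j) f j w).
Proof.
move=> Qf; elim: s => [|j s IH].
  rewrite [X in Q X](_ : _ = fun=> 0); first exact: Q_cst.
  by apply/funext => w; rewrite big_nil.
rewrite [X in Q X](_ : _ = fun w => if p j then f j w + \sum_(k <- s | p k) f k w
    else \sum_(k <- s | p k) f k w); last by apply/funext => w; rewrite big_cons.
by case pj: (p j) => //; apply: QD => //; exact: Qf.
Qed.

Lemma algebra_mulmx l m n (A : T -> 'M[R]_(l, m)) (B : T -> 'M[R]_(m, n)) :
  (forall a b, Q (fun w => A w a b)) -> (forall a b, Q (fun w => B w a b)) ->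
  forall a b, Q (fun w => (A w *m B w) a b).
Proof.
move=> QA QB a b; under eq_fun do rewrite mxE.
by apply: algebra_sum => j _; exact: QM.
Qed.

Lemma algebra_expmx d (A : T -> 'M[R]_d) k : (forall a b, Q (fun w => A w a b)) ->
  forall a b, Q (fun w => (A w ^+ k) a b).
Proof.
move=> QA; elim: k => [|k IH] a b.
  by under eq_fun do rewrite expr0; exact: Q_cst.
by under eq_fun do rewrite exprS -mulmxE; apply: algebra_mulmx.
Qed.

Lemma algebra_trace d (A : T -> 'M[R]_d) : (forall a b, Q (fun w => A w a b)) ->
  Q (fun w => \tr (A w)).
Proof. by move=> QA; apply: algebra_sum => j _; exact: QA. Qed.

End FunctionAlgebra.

Section BoundedMeasurable.
Context {R : realType} {disp : measure_display} {T : measurableType disp}.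

(** The bound is pointwise rather than almost sure, hence stable under composition with any
    measurable map. *)
Definition bounded_measurable (f : T -> R) : Prop :=
  measurable_fun setT f /\ exists M, forall w, `|f w| <= M.

Lemma bounded_measurable_cst (r : R) : bounded_measurable (fun=> r).
Proof. by split; [exact: measurable_cst|exists `|r|]. Qed.

Lemma bounded_measurableD f g : bounded_measurable f -> bounded_measurable g ->
  bounded_measurable (fun w => f w + g w).
Proof.
move=> [mf [M fM]] [mg [N gN]]; split; first exact: measurable_funD.
by exists (M + N) => w; rewrite (le_trans (ler_normD _ _))// lerD.
Qed.

Lemma bounded_measurableM f g : bounded_measurable f -> bounded_measurable g ->
  bounded_measurable (fun w => f w * g w).
Proof.
move=> [mf [M fM]] [mg [N gN]]; split; first exact: measurable_funM.
by exists (M * N) => w; rewrite normrM ler_pM.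
Qed.

Lemma bounded_measurableZ r f : bounded_measurable f ->
  bounded_measurable (fun w => r * f w).
Proof. exact/bounded_measurableM/bounded_measurable_cst. Qed.

Lemma bounded_measurable_sum I (s : seq I) (Q : pred I) (f : I -> T -> R) :
  (forall i, Q i -> bounded_measurable (f i)) ->
  bounded_measurable (fun w => \sum_(i <- s | Q i) f i w).
Proof.
exact: (algebra_sum bounded_measurable_cst bounded_measurableD).
Qed.

Lemma bounded_measurable_prod I (s : seq I) (Q : pred I) (f : I -> T -> R) :
  (forall i, Q i -> bounded_measurable (f i)) ->
  bounded_measurable (fun w => \prod_(i <- s | Q i) f i w).
Proof.
move=> bf; elim: s => [|i s IH].
  rewrite [X in bounded_measurable X](_ : _ = fun=> 1); first exact: bounded_measurable_cst.
  by apply/funext => w; rewrite big_nil.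
rewrite [X in bounded_measurable X](_ : _ = fun w => if Q i then f i w * \prod_(j <- s | Q j) f j w
    else \prod_(j <- s | Q j) f j w); last by apply/funext => w; rewrite big_cons.
by case Qi: (Q i) => //; apply: bounded_measurableM => //; exact: bf.
Qed.

Lemma bounded_measurable_indic (B : set T) : measurable B -> bounded_measurable \1_B.
Proof.
move=> mB; split; first exact: measurable_indic.
by exists 1 => w; rewrite indicE; case: (_ \in _); rewrite ?normr1 ?normr0.
Qed.

End BoundedMeasurable.

Lemma bounded_measurable_comp (R : realType) disp disp' (T : measurableType disp)
    (T' : measurableType disp') (x : T' -> T) (f : T -> R) :
  measurable_fun setT x -> bounded_measurable f -> bounded_measurable (fun w => f (x w)).
Proof.
move=> mx [mf [M fM]]; split; first exact: measurableT_comp.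
by exists M => w; exact: fM.
Qed.

Section BoundedExpectation.
Context {R : realType} {disp : measure_display} {T : measurableType disp}.
Variable P : probability T R.

Definition Ex (f : T -> R) : R := \int[P]_w f w.

Lemma bounded_measurable_integrable f : bounded_measurable f ->
  P.-integrable setT (EFin \o f).
Proof.
move=> [mf [M fM]]; apply: measurable_bounded_integrable => //.
  by rewrite (le_lt_trans (probability_le1 _ _))// ltry.
exists M; split; first exact: num_real.
by move=> x Mx w _; rewrite /= (le_trans (fM w))// ltW.
Qed.

Lemma Ex_cst r : Ex (fun=> r) = r.
Proof. by rewrite /Ex Rintegral_cst// (congr1 fine (probability_setT P) : fine _ = 1) mulr1. Qed.

Lemma ExD f g : bounded_measurable f -> bounded_measurable g ->
  Ex (fun w => f w + g w) = Ex f + Ex g.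
Proof. by move=> bf bg; apply: RintegralD => //; exact: bounded_measurable_integrable. Qed.

Lemma ExZ r f : bounded_measurable f -> Ex (fun w => r * f w) = r * Ex f.
Proof. by move=> bf; apply: RintegralZl => //; exact: bounded_measurable_integrable. Qed.

Lemma ExB f g : bounded_measurable f -> bounded_measurable g ->
  Ex (fun w => f w - g w) = Ex f - Ex g.
Proof. by move=> bf bg; apply: RintegralB => //; exact: bounded_measurable_integrable. Qed.

Lemma Ex_sum I (s : seq I) (Q : pred I) (f : I -> T -> R) :
  (forall i, Q i -> bounded_measurable (f i)) ->
  Ex (fun w => \sum_(i <- s | Q i) f i w) = \sum_(i <- s | Q i) Ex (f i).
Proof.
move=> bf; elim: s => [|i s IH].
  rewrite big_nil -[RHS]Ex_cst; congr Ex.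
  by apply/funext => w; rewrite big_nil.
rewrite big_cons [X in Ex X](_ : _ = fun w => if Q i then f i w + \sum_(j <- s | Q j) f j w
    else \sum_(j <- s | Q j) f j w); last by apply/funext => w; rewrite big_cons.
case Qi: (Q i) => //; rewrite ExD ?IH//; first exact: bf.
exact: bounded_measurable_sum.
Qed.

Lemma Ex_le f g : bounded_measurable f -> bounded_measurable g ->
  (forall w, f w <= g w) -> Ex f <= Ex g.
Proof.
by move=> bf bg fg; apply: le_Rintegral => //; exact: bounded_measurable_integrable.
Qed.

Lemma Ex_norm_le f c : bounded_measurable f -> (forall w, `|f w| <= c) -> `|Ex f| <= c.
Proof.
move=> bf fc; have bc r := @bounded_measurable_cst R disp T r.
rewrite ler_norml -[X in X <= _]Ex_cst -[X in _ && (_ <= X)]Ex_cst.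
by apply/andP; split; apply: Ex_le => // w; have := fc w; rewrite ler_norml => /andP[].
Qed.

Lemma Ex_indic (B : set T) : measurable B -> (Ex \1_B)%:E = P B.
Proof.
move=> mB; rewrite /Ex /Rintegral integral_indic// setIT fineK//.
exact: fin_num_measure.
Qed.

Lemma markov_bounded f c : bounded_measurable f -> (forall w, 0 <= f w) -> 0 < c ->
  (P [set w | (c < f w)%R] <= (Ex f / c)%:E)%E.
Proof.
move=> bf f0 c0.
have mB : measurable [set w | c < f w].
  rewrite (_ : [set w | c < f w] = setT `&` f @^-1` `]c, +oo[).
    by apply: bf.1 => //; exact: measurable_itv.
  by apply/seteqP; split=> w; rewrite /= in_itv/= andbT// => -[].
rewrite -Ex_indic// lee_fin mulrC -ExZ//; apply: Ex_le.
- exact: bounded_measurable_indic.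
- exact: bounded_measurableZ.
move=> w; rewrite indicE; case: (boolP (_ \in _)) => [|_]; last first.
  by rewrite mulr_ge0// invr_ge0 ltW.
by rewrite inE/= => cf; rewrite mulrC ler_pdivlMr// mul1r ltW.
Qed.

End BoundedExpectation.

(** * Product rule for independent variables *)

Section Independence.
Context {R : realType} {disp : measure_display} {T : measurableType disp}.
Variable P : probability T R.
Context {disp' : measure_display} {U : measurableType disp'}.

(** The sum counts the positive integers below or equal to y, so it is the integer part of y. *)
Lemma sum_levels (y : R) (K : nat) : 0 <= y <= K%:R ->
  `|y - \sum_(k < K) ((k.+1%:R <= y :> R)%R%:R : R)| <= 1.
Proof.
have full J : J%:R <= y -> \sum_(k < J) ((k.+1%:R <= y :> R)%R%:R : R) = J%:R.
  move=> Jy; rewrite (eq_bigr (fun=> 1)); first by rewrite sumr_const card_ord.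
  by move=> k _; rewrite (le_trans _ Jy)// ler_nat.
move=> /andP[y0]; elim: K => [|K IH] yK.
  by rewrite big_ord0 subr0 ger0_norm// (le_trans yK).
rewrite big_ord_recr/=; have [yK'|Ky] := leP y K%:R.
  by rewrite (_ : (K.+1%:R <= y) = false) ?addr0 ?IH// leNgt (le_lt_trans yK')// ltr_nat.
rewrite full; last exact: ltW.
rewrite -natr1 in yK *.
by case: (leP (K%:R + 1) y) => h /=; rewrite ler_norml; apply/andP; split; lra.
Qed.

(* Layer-cake approximation of g by combinations of indicators of its
   superlevel sets extends independence from events to functions. *)
Lemma Ex_mul_of_indic (x : {RV P >-> U}) (h : T -> R) : bounded_measurable h ->
  (forall B, measurable B -> Ex P (fun w => \1_B (x w) * h w) =
     Ex P (fun w => \1_B (x w)) * Ex P h) ->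
  forall g : U -> R, bounded_measurable g ->
    Ex P (fun w => g (x w) * h w) = Ex P (fun w => g (x w)) * Ex P h.
Proof.
move=> bh xh g bg; have [mg [M gM]] := bg; have [_ [H hH]] := bh.
have bx (f : U -> R) : bounded_measurable f -> bounded_measurable (fun w => f (x w)).
  by apply: bounded_measurable_comp; exact: measurable_funPT.
have M0 : 0 <= M by apply: le_trans (gM point).
have H0 : 0 <= H by apply: le_trans (hH point).
have approx (N : nat) : `|Ex P (fun w => g (x w) * h w) - Ex P (fun w => g (x w)) * Ex P h|
    <= N.+1%:R^-1 * (H + H).
  (* The shifted function g + M takes values in [0, 2M]; with N + 1 levels per unit, K levels cover
     this range and f approximates g uniformly within 1 / (N + 1). *)
  pose K := (Num.trunc (N.+1%:R * (M + M))).+1.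
  pose B (k : nat) := [set u : U | k.+1%:R <= N.+1%:R * (g u + M)].
  have mB k : measurable (B k).
    rewrite -[B k]setTI; apply: measurable_fun_le => //.
    by apply: measurable_funM => //; exact: measurable_funD.
  pose f u := N.+1%:R^-1 * (\sum_(k < K) \1_(B k) u) + (- M).
  have bf0 : bounded_measurable (fun u => \sum_(k < K) (\1_(B k) u : R)).
    by apply: bounded_measurable_sum => k _; exact: bounded_measurable_indic.
  have bf : bounded_measurable f.
    by apply: bounded_measurableD; [exact: bounded_measurableZ|exact: bounded_measurable_cst].
  have fg u : `|g u - f u| <= N.+1%:R^-1.
    have -> : g u - f u = N.+1%:R^-1 *
        (N.+1%:R * (g u + M) - \sum_(k < K) ((k.+1%:R <= N.+1%:R * (g u + M) :> R)%R%:R : R)).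
      have -> : g u - f u = g u + M - N.+1%:R^-1 * \sum_(k < K) \1_(B k) u by rewrite /f; ring.
      rewrite mulrBr mulKf//; congr (_ - _ * _); apply: eq_bigr => k _.
      by rewrite indicE; congr ((nat_of_bool _)%:R); apply/idP/idP => [/set_mem|/mem_set].
    rewrite normrM ger0_norm// ler_piMr//; apply: sum_levels.
    have := gM u; rewrite ler_norml => /andP[g1 g2]; rewrite mulr_ge0//=; last lra.
    rewrite ltW// /K; apply: le_lt_trans (truncnS_gt _).
    by rewrite ler_wpM2l//; lra.
  have ff : Ex P (fun w => f (x w) * h w) = Ex P (fun w => f (x w)) * Ex P h.
    have bB k : bounded_measurable (fun w => \1_(B k) (x w) : R).
      by apply: bx; exact: bounded_measurable_indic.
    have bBh k : bounded_measurable (fun w => \1_(B k) (x w) * h w).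
      exact: bounded_measurableM.
    rewrite /f (ExD _ (bounded_measurableZ _ (bx _ bf0)) (bounded_measurable_cst _)) Ex_cst.
    rewrite (ExZ _ _ (bx _ bf0)) Ex_sum// mulrDl -mulrA mulr_suml.
    under eq_bigr do rewrite -xh//.
    rewrite -Ex_sum// -!ExZ//; last exact: bounded_measurable_sum.
    rewrite -ExD; [|by apply: bounded_measurableZ; exact: bounded_measurable_sum
                   |exact: bounded_measurableZ].
    by congr Ex; apply/funext => w; rewrite mulrDl -mulrA mulr_suml.
  (* The defect of the product rule is linear in g and vanishes at f, so it is the defect of the
     small function g - f. *)
  have -> : Ex P (fun w => g (x w) * h w) - Ex P (fun w => g (x w)) * Ex P h =
      Ex P (fun w => (g (x w) - f (x w)) * h w) - Ex P (fun w => g (x w) - f (x w)) * Ex P h.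
    under [X in _ = Ex P X - _]eq_fun do rewrite mulrBl.
    rewrite (ExB _ (bx _ bg) (bx _ bf)) ExB; first by rewrite ff; ring.
    - by apply: bounded_measurableM => //; exact: bx.
    - by apply: bounded_measurableM => //; exact: bx.
  have bgf : bounded_measurable (fun w => g (x w) - f (x w)).
    under eq_fun do rewrite -mulN1r.
    by apply: bounded_measurableD; [|apply: bounded_measurableZ]; exact: bx.
  rewrite mulrDr (le_trans (ler_normB _ _))// lerD//.
    apply: Ex_norm_le; first exact: bounded_measurableM.
    by move=> w; rewrite normrM ler_pM.
  by rewrite normrM ler_pM//; apply: Ex_norm_le.
apply/eqP; rewrite -subr_eq0 -normr_le0 leNgt; apply/negP => lt0.
set D := `|_| in lt0 approx *.
have /archi_boundP := divr_ge0 (addr_ge0 H0 H0) (ltW lt0).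
rewrite ltr_pdivrMr// => h1; have := approx (Num.bound ((H + H) / D)).
rewrite leNgt mulrC ltr_pdivrMr// => /negP; apply.
by rewrite (lt_trans h1)// mulrC ltr_pM2l// ltr_nat.
Qed.

End Independence.

Section MutualIndependence.
Context {R : realType} {disp : measure_display} {T : measurableType disp}.
Variable P : probability T R.
Context {disp' : measure_display} {U : measurableType disp'}.
Variables (n : nat) (x : 'I_n -> {RV P >-> U}).
Hypothesis indep : mutually_independent x.

Let bounded_comp i (g : U -> R) :
  bounded_measurable g -> bounded_measurable (fun w => g (x i w)).
Proof. by apply: bounded_measurable_comp; exact: measurable_funPT. Qed.

Lemma Ex_prod_indic (B : 'I_n -> set U) : (forall i, measurable (B i)) ->
  Ex P (fun w => \prod_i \1_(B i) (x i w)) = \prod_i Ex P (fun w => \1_(B i) (x i w)).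
Proof.
move=> mB.
have mxB i : measurable (x i @^-1` B i).
  by rewrite -[X in measurable X]setTI; apply: measurable_funPT.
have E1 i : (Ex P (fun w => \1_(B i) (x i w)))%:E = P (x i @^-1` B i).
  by rewrite -Ex_indic.
apply: EFin_inj; rewrite -prodEFin; under [in RHS]eq_bigr do rewrite E1.
have := indep [set: 'I_n]%SET mB.
under [in X in _ = X -> _]eq_bigl do rewrite inE.
move=> <-; rewrite -Ex_indic; last by apply: fin_bigcap_measurable.
congr (Ex P _)%:E; apply/funext => w; rewrite indicE.
case: (boolP (w \in _)) => [|wB].
  rewrite inE => wB; rewrite big1// => i _.
  by rewrite indicE mem_set//; apply: wB; rewrite /= inE.
have [i wBi] : exists i, ~ B i (x i w).
  by apply/existsNP => h; move/negP: wB; apply; rewrite inE => i _; exact: h.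
by rewrite (bigD1 i)//= indicE memNset// mul0r.
Qed.

(** Indicators are replaced by bounded functions one index at a time: in [key k] the factors of
    index at least k are still indicators. The factor of index k is freed by [Ex_mul_of_indic], with
    the product of all others as h. *)
Lemma Ex_prod (g : 'I_n -> U -> R) : (forall i, bounded_measurable (g i)) ->
  Ex P (fun w => \prod_i g i (x i w)) = \prod_i Ex P (fun w => g i (x i w)).
Proof.
suff key k : forall g : 'I_n -> U -> R, (forall i, bounded_measurable (g i)) ->
    (forall i : 'I_n, (k <= i)%N -> exists2 B, measurable B & g i = \1_B) ->
    Ex P (fun w => \prod_i g i (x i w)) = \prod_i Ex P (fun w => g i (x i w)).
  by move=> bg; apply: (key n) => // i; rewrite leqNgt ltn_ord.
elim: k => {g} [|k IH] g bg indg.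
  have /choice[B BP] i : exists B, measurable B /\ g i = \1_B.
    by have [//|B mB gB] := indg i; exists B.
  under [X in Ex P X]eq_fun do under eq_bigr do rewrite (BP _).2.
  by rewrite Ex_prod_indic => [|i]; [apply: eq_bigr => i _; rewrite (BP i).2|exact: (BP i).1].
have [nk|kn] := leqP n k.
  by apply: IH => // i ki; have := ltn_ord i; rewrite ltnNge (leq_trans nk ki).
pose i := Ordinal kn; pose h w := \prod_(j | j != i) g j (x j w).
have bh : bounded_measurable h by apply: bounded_measurable_prod => j _; exact: bounded_comp.
have hB B : measurable B -> Ex P (fun w => \1_B (x i w) * h w) =
    Ex P (fun w => \1_B (x i w)) * \prod_(j | j != i) Ex P (fun w => g j (x j w)).
  move=> mB; pose g' j := if j == i then \1_B : U -> R else g j.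
  have g'i : g' i = \1_B by rewrite /g' eqxx.
  have g'j j : j != i -> g' j = g j by rewrite /g' => /negbTE ->.
  transitivity (Ex P (fun w => \prod_j g' j (x j w))).
    congr Ex; apply/funext => w; rewrite (bigD1 i)//= g'i; congr (_ * _).
    by apply: eq_bigr => j ji; rewrite g'j.
  rewrite IH.
  - by rewrite (bigD1 i)//= g'i; congr (_ * _); apply: eq_bigr => j ji; rewrite g'j.
  - by move=> j; rewrite /g'; case: ifP => // _; exact: bounded_measurable_indic.
  - move=> j; rewrite leq_eqVlt => /predU1P[kj|kj].
      by exists B => //; rewrite (_ : j = i) //; apply: val_inj.
    have ji : j != i by rewrite -val_eqE/= gtn_eqF.
    by rewrite g'j//; exact: indg.
have hE : Ex P h = \prod_(j | j != i) Ex P (fun w => g j (x j w)).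
  have := hB setT measurableT; rewrite (_ : (fun w => \1_setT (x i w)) = fun=> 1); last first.
    by apply/funext => w; rewrite indicT.
  rewrite Ex_cst mul1r => <-; congr Ex; apply/funext => w.
  by rewrite indicT mul1r.
rewrite (bigD1 i)//= -hE -Ex_mul_of_indic//.
  by congr Ex; apply/funext => w; rewrite (bigD1 i).
by move=> B mB; rewrite hB// hE.
Qed.

Variable i : 'I_n.

(* Sums of products, rather than functions measurable for the sigma-algebra of the
   x j with j != i: the product rule then extends by linearity alone. *)
Inductive free_of : (T -> R) -> Prop :=
| FreeProd (c : R) (g : 'I_n -> U -> R) : (forall j, bounded_measurable (g j)) ->
    free_of (fun w => c * \prod_(j | j != i) g j (x j w))
| FreeAdd f g : free_of f -> free_of g -> free_of (fun w => f w + g w).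

Lemma free_of_cst c : free_of (fun=> c).
Proof.
rewrite (_ : (fun=> c) = fun w => c * \prod_(j | j != i) (fun=> 1) (x j w)).
  by apply: (@FreeProd c (fun _ _ => 1)) => j; exact: bounded_measurable_cst.
by apply/funext => w; rewrite big1 ?mulr1.
Qed.

Lemma free_of_comp j (g : U -> R) : j != i -> bounded_measurable g ->
  free_of (fun w => g (x j w)).
Proof.
move=> ji bg; pose G k := if k == j then g else fun=> 1.
rewrite (_ : (fun w => _) = fun w => 1 * \prod_(k | k != i) G k (x k w)).
  apply: FreeProd => k; rewrite /G; case: ifP => // _; exact: bounded_measurable_cst.
apply/funext => w; rewrite mul1r (bigD1 j)//= big1 ?mulr1 /G ?eqxx//.
by move=> k /andP[_ /negbTE ->].
Qed.

Lemma free_ofM f g : free_of f -> free_of g -> free_of (fun w => f w * g w).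
Proof.
move=> ff; elim: g / => [c g bg|g1 g2 _ IH1 _ IH2]; last first.
  rewrite (_ : (fun w => _) = fun w => f w * g1 w + f w * g2 w); first exact: FreeAdd.
  by apply/funext => w; rewrite mulrDr.
elim: f / ff => [c' g' bg'|f1 f2 _ IH1 _ IH2]; last first.
  rewrite (_ : (fun w => (f1 w + f2 w) * _) = fun w =>
    f1 w * (c * \prod_(j | j != i) g j (x j w)) +
    f2 w * (c * \prod_(j | j != i) g j (x j w))); first exact: FreeAdd.
  by apply/funext => w; rewrite mulrDl.
rewrite (_ : (fun w => _) =
    fun w => c' * c * \prod_(j | j != i) (fun u => g' j u * g j u) (x j w)).
  by apply: (@FreeProd _ (fun j u => g' j u * g j u)) => j; exact: bounded_measurableM.
by apply/funext => w; rewrite mulrACA -big_split.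
Qed.

Lemma free_of_sum I (s : seq I) (Q : pred I) (f : I -> T -> R) :
  (forall j, Q j -> free_of (f j)) -> free_of (fun w => \sum_(j <- s | Q j) f j w).
Proof. exact: (algebra_sum free_of_cst FreeAdd). Qed.

Lemma free_of_bounded f : free_of f -> bounded_measurable f.
Proof.
elim=> [c g bg|f1 f2 _ b1 _ b2]; last exact: bounded_measurableD.
apply: bounded_measurableZ; apply: bounded_measurable_prod => j _.
exact: bounded_comp.
Qed.

Lemma Ex_free_of (g : U -> R) f : bounded_measurable g -> free_of f ->
  Ex P (fun w => g (x i w) * f w) = Ex P (fun w => g (x i w)) * Ex P f.
Proof.
move=> bg; elim=> [c h bh|f1 f2 ff1 IH1 ff2 IH2]; last first.
  have b1 := free_of_bounded ff1; have b2 := free_of_bounded ff2.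
  rewrite ExD// mulrDr -IH1 -IH2 -ExD; last 2 first.
  - by apply: bounded_measurableM => //; exact: bounded_comp.
  - by apply: bounded_measurableM => //; exact: bounded_comp.
  by congr Ex; apply/funext => w; rewrite mulrDr.
have prodE (G : U -> R) : bounded_measurable G ->
    Ex P (fun w => G (x i w) * \prod_(j | j != i) h j (x j w)) =
    Ex P (fun w => G (x i w)) * \prod_(j | j != i) Ex P (fun w => h j (x j w)).
  move=> bG; pose h' j := if j == i then G else h j.
  have h'i : h' i = G by rewrite /h' eqxx.
  have h'j j : j != i -> h' j = h j by rewrite /h' => /negbTE ->.
  transitivity (Ex P (fun w => \prod_j h' j (x j w))).
    congr Ex; apply/funext => w; rewrite [in RHS](bigD1 i)//= h'i; congr (_ * _).
    by apply: eq_bigr => j ji; rewrite h'j.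
  rewrite Ex_prod; last by move=> j; rewrite /h'; case: ifP.
  by rewrite (bigD1 i)//= h'i; congr (_ * _); apply: eq_bigr => j ji; rewrite h'j.
have bp : bounded_measurable (fun w => \prod_(j | j != i) h j (x j w)).
  by apply: bounded_measurable_prod => j _; exact: bounded_comp.
have := prodE _ (bounded_measurable_cst 1); rewrite Ex_cst mul1r.
under [X in Ex P X = _]eq_fun do rewrite mul1r.
move=> pE; rewrite ExZ// pE mulrCA -prodE// -ExZ.
  by congr Ex; apply/funext => w; rewrite mulrCA.
by apply: bounded_measurableM => //; exact: bounded_comp.
Qed.

End MutualIndependence.

(** * Moments of the centered sum *)

Section MomentBound.
Context {R : realType} {disp : measure_display} {T : measurableType disp}.
Variable P : probability T R.
Context {disp' : measure_display} {U : measurableType disp'}.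
Variables (n d : nat) (x : 'I_n -> {RV P >-> U}) (phi : U -> 'rV[R]_d) (m : R).
Hypothesis indep : mutually_independent x.
Hypotheses (n_gt0 : (0 < n)%N) (m1 : 1 <= m).
Hypothesis phi_bounded : forall a, bounded_measurable (fun u => phi u 0 a).
Hypothesis phi_m : forall u, dot (phi u) (phi u) <= m.
Hypothesis isotropic : forall i a b,
  Ex P (fun w => phi (x i w) 0 a * phi (x i w) 0 b) = (a == b)%:R.

Definition centered_term (u : U) : 'M[R]_d :=
  n%:R^-1 *: ((phi u)^T *m phi u) - n%:R^-1 *: 1%:M.

Definition centered_sum (w : T) : 'M[R]_d := \sum_i centered_term (x i w).

Lemma centered_sum_sym w : (centered_sum w)^T = centered_sum w.
Proof.
rewrite /centered_sum linear_sum/=; apply: eq_bigr => i _.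
by rewrite /centered_term linearB/= !linearZ/= trmx_rank_one trmx1.
Qed.

Lemma centered_termE u a b :
  centered_term u a b = n%:R^-1 * (phi u 0 a * phi u 0 b) + - (n%:R^-1 * (a == b)%:R).
Proof. by rewrite !mxE big_ord1 !mxE. Qed.

Lemma centered_term_bounded a b : bounded_measurable (fun u => centered_term u a b).
Proof.
under eq_fun do rewrite centered_termE.
apply: bounded_measurableD; last exact: bounded_measurable_cst.
by apply: bounded_measurableZ; exact: bounded_measurableM.
Qed.

Let bounded_comp i (g : U -> R) :
  bounded_measurable g -> bounded_measurable (fun w => g (x i w)).
Proof. by apply: bounded_measurable_comp; exact: measurable_funPT. Qed.

Lemma Ex_centered_term i a b : Ex P (fun w => centered_term (x i w) a b) = 0.
Proof.
under [X in Ex P X]eq_fun do rewrite centered_termE.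
have bphi : bounded_measurable (fun w => phi (x i w) 0 a * phi (x i w) 0 b).
  by apply: (@bounded_comp i (fun u => phi u 0 a * phi u 0 b)); exact: bounded_measurableM.
rewrite ExD; [|exact: bounded_measurableZ|exact: bounded_measurable_cst].
by rewrite ExZ// Ex_cst isotropic subrr.
Qed.

Lemma bounded_tr_centered i q : bounded_measurable (fun w =>
  \tr (centered_term (x i w) *m (\sum_(j | j != i) centered_term (x j w)) ^+ q)).
Proof.
apply: (algebra_trace (@bounded_measurable_cst _ _ _) (@bounded_measurableD _ _ _)).
apply: (algebra_mulmx (@bounded_measurable_cst _ _ _) (@bounded_measurableD _ _ _)
  (@bounded_measurableM _ _ _)).
  move=> a b; apply: (@bounded_comp i (fun u => centered_term u a b)).
  exact: centered_term_bounded.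
apply: (algebra_expmx (@bounded_measurable_cst _ _ _) (@bounded_measurableD _ _ _)
  (@bounded_measurableM _ _ _)) => a b.
under eq_fun do rewrite summxE; apply: bounded_measurable_sum => j _.
by apply: (@bounded_comp j (fun u => centered_term u a b)); exact: centered_term_bounded.
Qed.

Lemma Ex_tr_centered i q :
  Ex P (fun w => \tr (centered_term (x i w) *m
    (\sum_(j | j != i) centered_term (x j w)) ^+ q)) = 0.
Proof.
pose S' w := \sum_(j | j != i) centered_term (x j w).
have fS a b : free_of x i (fun w => (S' w ^+ q) a b).
  apply: (algebra_expmx (@free_of_cst _ _ _ _ _ _ _ x i) (@FreeAdd _ _ _ _ _ _ _ x i)
    (@free_ofM _ _ _ _ _ _ _ x i)) => {}a {}b.
  rewrite /S'; under eq_fun do rewrite summxE.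
  apply: free_of_sum => j ji.
  by apply: (@free_of_comp _ _ _ _ _ _ _ x i j (fun u => centered_term u a b)) => //;
    exact: centered_term_bounded.
have E0 a b : Ex P (fun w => centered_term (x i w) a b * (S' w ^+ q) b a) = 0.
  rewrite (@Ex_free_of _ _ _ _ _ _ _ _ indep i (fun u => centered_term u a b))//.
    by rewrite Ex_centered_term mul0r.
  exact: centered_term_bounded.
have bE a b : bounded_measurable (fun w => centered_term (x i w) a b * (S' w ^+ q) b a).
  apply: bounded_measurableM; last exact: free_of_bounded.
  by apply: (@bounded_comp i (fun u => centered_term u a b)); exact: centered_term_bounded.
rewrite (_ : (fun w => _) = fun w =>
    \sum_a \sum_b centered_term (x i w) a b * (S' w ^+ q) b a); last first.
  by apply/funext => w; apply: eq_bigr => a _; rewrite mxE.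
rewrite Ex_sum => [|a _]; last exact: bounded_measurable_sum.
by apply: big1 => a _; rewrite Ex_sum//; apply: big1 => b _.
Qed.

Lemma bounded_tr_centered_sum q : bounded_measurable (fun w => \tr (centered_sum w ^+ q)).
Proof.
apply: (algebra_trace (@bounded_measurable_cst _ _ _) (@bounded_measurableD _ _ _)).
apply: (algebra_expmx (@bounded_measurable_cst _ _ _) (@bounded_measurableD _ _ _)
  (@bounded_measurableM _ _ _)) => a b.
under eq_fun do rewrite summxE; apply: bounded_measurable_sum => j _.
by apply: (@bounded_comp j (fun u => centered_term u a b)); exact: centered_term_bounded.
Qed.

Lemma trace_moment_le (L : R) k : 0 <= L ->
  5 * (k.*2.+1%:R * (m / n%:R)) <= L -> 5 * (k.*2.+1%:R * (m / n%:R)) <= L ^+ 2 ->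
  Ex P (fun w => \tr (centered_sum w ^+ k.*2.+2)) <= d%:R * L ^+ k.*2.+2.
Proof.
move=> L0 kL kL2; set c := k.*2.+1%:R * (m / n%:R) in kL kL2.
pose t i q w := \tr (centered_term (x i w) *m
  (\sum_(j | j != i) centered_term (x j w)) ^+ q).
have bt i q : bounded_measurable (t i q) by exact: bounded_tr_centered.
have Et i q : Ex P (t i q) = 0 by exact: Ex_tr_centered.
pose Z i w := 2 * t i k.*2.+1 w + c * t i k.*2 w +
  - (c * (2 / n%:R) * k.*2%:R) * t i k.*2.-1 w.
have bZ2 i : bounded_measurable (fun w => 2 * t i k.*2.+1 w + c * t i k.*2 w).
  by apply: bounded_measurableD; exact: bounded_measurableZ.
have bZ i : bounded_measurable (Z i).
  by apply: bounded_measurableD => //; exact: bounded_measurableZ.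
have EZ i : Ex P (Z i) = 0.
  rewrite /Z ExD ?ExD ?ExZ ?Et ?mulr0 ?addr0//; exact: bounded_measurableZ.
have bS : bounded_measurable (fun w => \sum_i Z i w) by exact: bounded_measurable_sum.
(* Adding the mean-zero sum inside the expectation reduces the claim to the pointwise trace
   inequality. *)
have -> : d%:R * L ^+ k.*2.+2 = Ex P (fun w => d%:R * L ^+ k.*2.+2 + \sum_i Z i w).
  rewrite ExD ?Ex_cst//; last exact: bounded_measurable_cst.
  by rewrite Ex_sum// big1 ?addr0.
apply: Ex_le.
- exact: bounded_tr_centered_sum.
- by apply: bounded_measurableD => //; exact: bounded_measurable_cst.
move=> w.
exact: (tr_centered_sum_le n_gt0 m1 (fun i => phi_m (x i w)) L0 kL kL2).
Qed.

Lemma centered_sum_tail (delta : R) k : 0 < delta ->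
  10 * (k.*2.+1%:R * (m / n%:R)) <= delta -> 20 * (k.*2.+1%:R * (m / n%:R)) <= delta ^+ 2 ->
  (P [set w | (delta ^+ k.*2.+2 < \tr (centered_sum w ^+ k.*2.+2))%R] <=
   (d%:R * 2^-1 ^+ k.*2.+2)%:E)%E.
Proof.
move=> d0 kd kd2; have p0 : 0 < delta ^+ k.*2.+2 by exact: exprn_gt0.
apply: le_trans (markov_bounded _ (bounded_tr_centered_sum _) _ p0) _.
  have psd1 : psdmx (1%:M : 'M[R]_d).
    by apply/psdmxP; split=> [|u]; rewrite ?trmx1// quad1 dot_ge0.
  by move=> w; have := tr_psd_even k.+1 (centered_sum_sym w) psd1; rewrite mul1mx.
(* The moment bound is taken at L = delta / 2, which turns the constants 5 and 5 into 10 and 20. *)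
rewrite lee_fin ler_pdivrMr// -mulrA -exprMn.
by apply: trace_moment_le; [rewrite mulr_ge0// ltW| |rewrite exprMn]; lra.
Qed.

End MomentBound.

(** * Perturbation and measurability of eigenvalues *)

Section EigenvaluePerturbation.
Context {R : realType}.

Lemma eigval_relative_le d (A B : 'M[R]_d) (i : 'I_d) (delta : R) :
  psdmx A -> psdmx B -> 0 <= delta ->
  (forall u, `|quad B u - quad A u| <= delta * quad A u) ->
  `|eigval B i - eigval A i| <= eigval A i * delta.
Proof.
move=> pA pB d0 AB; have [sA _] := (psdmxP A).1 pA; have [sB _] := (psdmxP B).1 pB.
have lA := eigval_ge0 i pA; have lB := eigval_ge0 i pB.
have upper : eigval B i <= (1 + delta) * eigval A i + 0.
  apply: eigval_le_affine => // [|u]; first lra.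
  by have := AB u; rewrite ler_norml => /andP[_ h]; lra.
have lower : (1 - delta) * eigval A i <= eigval B i.
  (* The affine comparison needs a nonnegative slope 1 - delta; for larger delta the bound is
     trivial because eigenvalues of B are nonnegative. *)
  case: (leP delta 1) => d1; last by apply: le_trans lB; rewrite mulr_le0_ge0//; lra.
  rewrite -[leLHS]addr0; apply: eigval_affine_le => // [|u]; first lra.
  by have := AB u; rewrite ler_norml => /andP[h _]; lra.
by rewrite ler_norml; apply/andP; split; lra.
Qed.

Lemma quad_le_entries d (A : 'M[R]_d) (e : R) : (forall a b, `|A a b| <= e) ->
  forall u, quad A u <= d%:R * e * dot u u.
Proof.
move=> Ae u.
have -> : quad A u = \sum_b \sum_a u 0 a * A a b * u 0 b.
  by rewrite /quad dotE; apply: eq_bigr => b _; rewrite mxE mulr_suml.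
apply: (@le_trans _ _ (\sum_b \sum_a e / 2 * (u 0 a ^+ 2 + u 0 b ^+ 2))).
  apply: ler_sum => b _; apply: ler_sum => a _.
  have e0 : 0 <= e by exact: le_trans (Ae a b).
  apply: le_trans (ler_norm _) _; rewrite !normrM mulrAC.
  have : `|u 0 a| * `|u 0 b| * `|A a b| <= `|u 0 a| * `|u 0 b| * e.
    by rewrite ler_wpM2l// mulr_ge0.
  have := sqr_ge0 (`|u 0 a| - `|u 0 b|); rewrite sqrrB !real_normK ?num_real// => h1 h2.
  by nra.
have DE : \sum_(a < d) u 0 a ^+ 2 = dot u u.
  by rewrite dotE; apply: eq_bigr => a _; rewrite expr2.
under eq_bigr do rewrite -mulr_sumr big_split/= DE sumr_const card_ord.
rewrite -mulr_sumr big_split/= sumr_const card_ord sumrMnl DE -mulr_natl.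
by rewrite le_eqVlt; apply/orP; left; apply/eqP; field.
Qed.

Lemma eigval_entries_le d (A B : 'M[R]_d) (i : 'I_d) (e : R) : A^T = A -> B^T = B ->
  (forall a b, `|A a b - B a b| <= e) -> eigval A i <= eigval B i + d%:R * e.
Proof.
move=> sA sB AB; rewrite -(mul1r (eigval B i)); apply: eigval_le_affine => // u.
rewrite mul1r -lerBlDl -quadB; apply: quad_le_entries => a b.
by rewrite !mxE.
Qed.

(* The superlevel set {eigval > a} is a countable union, over symmetric matrices B
   with entries in a grid of mesh 1 / N.+1, of cubes around B on which Weyl's
   inequality forces eigval > a. *)
Lemma measurable_eigval disp (T : measurableType disp) d (A : T -> 'M[R]_d) (i : 'I_d) :
  (forall w, (A w)^T = A w) -> (forall a b, measurable_fun setT (fun w => A w a b)) ->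
  measurable_fun setT (fun w => eigval (A w) i).
Proof.
move=> sA mA; move=> mT; apply: (measurability _ (RGenOInfty.measurableE R)) => //.
move=> /= _ [_ [r ->] <-]; rewrite setTI.
pose grid (p : nat * 'M[int]_d) : 'M[R]_d := \matrix_(a, b) ((p.2 a b)%:~R / p.1.+1%:R).
pose ok (p : nat * 'M[int]_d) : Prop :=
  (grid p)^T = grid p /\ r < eigval (grid p) i - d%:R * p.1.+1%:R^-1.
pose cube (p : nat * 'M[int]_d) : set T :=
  [set w | ok p /\ forall a b, `|A w a b - grid p a b| <= p.1.+1%:R^-1].
rewrite (_ : _ @^-1` _ = \bigcup_p cube p).
  apply: countable_bigcupT_measurable; first exact: countableP.
  move=> p; have [okp|nokp] := pselect (ok p); last first.
    by rewrite (_ : cube p = set0)//; apply/seteqP; split=> w // -[].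
  rewrite (_ : cube p = \bigcap_(ab in [set: 'I_d * 'I_d])
      [set w | `|A w ab.1 ab.2 - grid p ab.1 ab.2| <= p.1.+1%:R^-1]); last first.
    apply/seteqP; split=> w; first by move=> [_ h] [a b] _; exact: h.
    by move=> h; split=> // a b; exact: (h (a, b) I).
  apply: fin_bigcap_measurable => // -[a b] _ /=.
  rewrite -[X in measurable X]setTI; apply: measurable_fun_le => //.
  by apply: measurableT_comp => //; apply: measurable_funB.
apply/seteqP; split=> w /=; rewrite in_itv/= andbT.
  move=> rA; pose e := eigval (A w) i - r.
  have e0 : 0 < e by rewrite subr_gt0.
  (* The margin e must exceed two errors of size d / (N + 1): the one from rounding A w to the grid
     and the one reserved in [ok]. *)
  pose N := Num.bound (2 * d%:R / e).
  pose K : 'M[int]_d := \matrix_(a, b) Num.floor (N.+1%:R * A w a b).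
  have N0 : 0 < N.+1%:R :> R by [].
  have close a b : `|A w a b - grid (N, K) a b| <= N.+1%:R^-1.
    have := floor_itv (N.+1%:R * A w a b); rewrite intrD /= => /andP[f1 f2].
    rewrite !mxE /= (_ : A w a b - _ = N.+1%:R^-1 *
      (N.+1%:R * A w a b - (Num.floor (N.+1%:R * A w a b))%:~R)); last by field; rewrite gt_eqF.
    rewrite normrM ger0_norm// ler_piMr// ler_norml; apply/andP; split; lra.
  have sG : (grid (N, K))^T = grid (N, K).
    by apply/matrixP => a b; rewrite !mxE -[in LHS](sA w) mxE.
  have close' a b : `|grid (N, K) a b - A w a b| <= N.+1%:R^-1 by rewrite distrC.
  exists (N, K) => //; split=> //; split=> //=.
  have := eigval_entries_le i (sA w) sG close.
  have : 2 * (d%:R * N.+1%:R^-1) < e.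
    rewrite mulrA ltr_pdivrMr// [ltRHS]mulrC -ltr_pdivrMr//.
    have NN : N%:R < N.+1%:R :> R by rewrite ltr_nat.
    by apply: lt_trans NN; apply: archi_boundP; rewrite divr_ge0// ltW.
  by rewrite /e; move: (_ / _) (eigval _ _) (eigval _ _) => q l1 l2 h1 h2; lra.
move=> [[N K] _ [[sG rG] close]].
have close' a b : `|grid (N, K) a b - A w a b| <= N.+1%:R^-1 by rewrite distrC; exact: close.
have := eigval_entries_le i sG (sA w) close'.
move: rG => /=; move: (_ / _) (eigval _ _) (eigval _ _) => q l1 l2 h1 h2; lra.
Qed.

End EigenvaluePerturbation.

(** * Sample covariance *)

Section MatrixExpectation.
Context {R : realType} {disp : measure_display} {T : measurableType disp}.
Variable P : probability T R.

(** Entries of the Gram matrix are integrable but possibly unbounded, so the rules for [Ex] do not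
    cover them. *)
Lemma Rintegral_lincomb I (s : seq I) (c : I -> R) (f : I -> T -> R) :
  (forall j, P.-integrable setT (EFin \o f j)) ->
  P.-integrable setT (EFin \o (fun w => \sum_(j <- s) c j * f j w)) /\
  \int[P]_w (\sum_(j <- s) c j * f j w) = \sum_(j <- s) c j * \int[P]_w f j w.
Proof.
move=> intf; elim: s => [|j s [IH1 IH2]].
  rewrite (_ : (fun w => _) = fun=> 0); last by apply/funext => w; rewrite big_nil.
  split; first exact: integrable0.
  by rewrite big_nil Rintegral_cst// mul0r.
rewrite (_ : (fun w => _) = fun w => c j * f j w + \sum_(k <- s) c k * f k w); last first.
  by apply/funext => w; rewrite big_cons.
have intcf : P.-integrable setT (EFin \o (fun w => c j * f j w)).
  rewrite (_ : EFin \o _ = fun w => ((c j)%:E * (f j w)%:E)%E) //.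
  exact: (integrableZl measurableT (c j) (intf j)).
split; last by rewrite RintegralD// RintegralZl// IH2 big_cons.
rewrite (_ : EFin \o _ = fun w => ((c j * f j w)%:E + (\sum_(k <- s) c k * f k w)%:E)%E) //.
exact: (integrableD measurableT intcf IH1).
Qed.

Lemma mx_expectationE n d (A : T -> 'M[R]_(n, d)) a b :
  mx_expectation P A a b = \int[P]_w A w a b.
Proof. by rewrite mxE unlock. Qed.

Lemma mx_expectation_mull l n d (B : 'M[R]_(l, n)) (A : T -> 'M[R]_(n, d)) :
  mx_integrable P A -> mx_integrable P (fun w => B *m A w) /\
  mx_expectation P (fun w => B *m A w) = B *m mx_expectation P A.
Proof.
move=> intA.
have key a b := @Rintegral_lincomb _ (index_enum 'I_n) (B a) (fun j w => A w j b) (intA ^~ b).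
split=> [a b|].
  have [+ _] := key a b; congr (P.-integrable setT _).
  by apply/funext => w /=; rewrite mxE.
apply/matrixP => a b; rewrite [RHS]mxE.
transitivity (\sum_j B a j * \int[P]_w A w j b); last first.
  apply: eq_bigr => j _. by rewrite (mx_expectationE A).
rewrite (mx_expectationE (fun w => B *m A w)) -(key a b).2; apply: eq_Rintegral => w _.
by rewrite mxE.
Qed.

Lemma mx_expectation_tr n d (A : T -> 'M[R]_(n, d)) :
  mx_expectation P (fun w => (A w)^T) = (mx_expectation P A)^T.
Proof.
apply/matrixP => a b; rewrite [RHS]mxE (mx_expectationE A) (mx_expectationE (fun w => (A w)^T)).
by apply: eq_Rintegral => w _; rewrite mxE.
Qed.

Lemma mx_expectation_mulr n d l (A : T -> 'M[R]_(n, d)) (B : 'M[R]_(d, l)) :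
  mx_integrable P A -> mx_expectation P (fun w => A w *m B) = mx_expectation P A *m B.
Proof.
move=> intA; have intAT : mx_integrable P (fun w => (A w)^T).
  by move=> a b; have := intA b a; congr (P.-integrable setT _); apply/funext => w; rewrite mxE.
apply: trmx_inj; rewrite trmx_mul -!mx_expectation_tr.
rewrite -(mx_expectation_mull B^T intAT).2; congr mx_expectation.
by apply/funext => w; rewrite trmx_mul.
Qed.

Lemma psdmx_expectation d (A : T -> 'M[R]_d) : mx_integrable P A ->
  (forall w, psdmx (A w)) -> psdmx (mx_expectation P A).
Proof.
move=> intA pA; apply/psdmxP; split.
  by rewrite -mx_expectation_tr; congr mx_expectation; apply/funext => w; have [] := pA w.
move=> u; have [intuA uA] := mx_expectation_mull u intA.
rewrite /quad /dot -uA -mx_expectation_mulr// (mx_expectationE (fun w => u *m A w *m u^T)).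
by apply: Rintegral_ge0 => w _; have /psdmxP[_] := pA w; exact.
Qed.

End MatrixExpectation.

Section Gram.
Context {R : realType}.

Lemma psdmx_gram n d (X : 'M[R]_(n, d)) : psdmx (gram X).
Proof.
apply/psdmxP; split; first by rewrite /gram linearZ/= trmx_mul trmxK.
move=> u; rewrite /gram quadZ mulr_ge0// ?invr_ge0//.
have -> : quad (X^T *m X) u = dot (u *m X^T) (u *m X^T).
  by rewrite /quad /dot trmx_mul trmxK !mulmxA.
exact: dot_ge0.
Qed.

Lemma gramE n d (X : 'M[R]_(n, d)) :
  gram X = \sum_i n%:R^-1 *: ((row i X)^T *m row i X).
Proof.
rewrite -scaler_sumr; congr (_ *: _); apply/matrixP => a b.
rewrite mxE summxE; apply: eq_bigr => i _.
by rewrite !mxE big_ord1 !mxE.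
Qed.

Lemma gram_conj n d (X : 'M[R]_(n, d)) (B : 'M[R]_d) : B^T = B ->
  B *m gram X *m B = \sum_i n%:R^-1 *: ((row i X *m B)^T *m (row i X *m B)).
Proof.
move=> sB; rewrite gramE mulmx_sumr mulmx_suml; apply: eq_bigr => i _.
by rewrite -scalemxAr -scalemxAl trmx_mul sB !mulmxA.
Qed.

End Gram.

Section TailConstant.
Context {R : realType}.

(** From 1/2 <= exp(-1/2) one gets 2^(-(k+2)) <= exp(-(k+2)/2) <= exp(-t^2/128), the origin of
    1/128. Passing from exponent k + 1 to k + 2 costs the factor 2 of the final probability. *)
Lemma half_pow_le_expR (t : R) k : t ^+ 2 < 64 * k.+2%:R ->
  2^-1 ^+ k.*2.+2 <= 2 * expR (- (128^-1 * t ^+ 2)).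
Proof.
move=> tk.
have h : 2^-1 <= expR (- 2^-1 : R).
  by apply: le_trans (expR_ge1Dx _); lra.
have : 2^-1 ^+ k.+2 <= expR (- (128^-1 * t ^+ 2)).
  apply: (@le_trans _ _ (expR (- 2^-1) ^+ k.+2)).
    by rewrite lerXn2r// nnegrE ?invr_ge0// expR_ge0.
  rewrite -expRM_natl ler_expR; lra.
have : 2^-1 ^+ k.*2.+2 <= 2^-1 ^+ k.+1 :> R.
  by apply: ler_wiXn2l; [lra|lra|rewrite ltnS -addnn; lia].
rewrite [_ ^+ k.+2]exprS; lra.
Qed.

End TailConstant.

Lemma Ex_identically_distributed (R : realType) disp (T : measurableType disp)
    (P : probability T R) disp' (U : measurableType disp') (I : Type)
    (x : I -> {RV P >-> U}) (g : U -> R) i k :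
  identically_distributed x -> bounded_measurable g ->
  Ex P (fun w => g (x i w)) = Ex P (fun w => g (x k w)).
Proof.
move=> idx bg.
have E j : Ex P (fun w => g (x j w)) = fine (\int[distribution P (x j)]_u (g u)%:E)%E.
  rewrite integral_distribution//; first exact/measurable_EFinP/bg.1.
  apply: (@bounded_measurable_integrable _ _ _ P (fun w => g (x j w))).
  by apply: bounded_measurable_comp => //; exact: measurable_funPT.
rewrite !E; congr fine; apply: eq_measure_integral => B mB _; exact: idx.
Qed.

(** * Whitening and truncation *)

Section Whitening.
Context {R : realType}.
Variables (d : nat) (V : 'M[R]_d) (m : R).

Definition whiten (u : d.-tuple R) : 'rV[R]_d := (\row_j tnth u j) *m V.

(* The z_i are bounded only almost surely; truncation makes every moment finite
   and every independence identity available for bounded functions. *)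
Definition truncated_whiten (u : d.-tuple R) : 'rV[R]_d :=
  if dot (whiten u) (whiten u) <= m then whiten u else 0.

Lemma measurable_whiten a : measurable_fun setT (fun u => whiten u 0 a).
Proof.
under eq_fun do rewrite mxE.
apply: measurable_sum => j; apply: measurable_funM; last exact: measurable_cst.
by under eq_fun do rewrite mxE; exact: measurable_tnth.
Qed.

Lemma truncated_whiten_le u : 0 <= m ->
  dot (truncated_whiten u) (truncated_whiten u) <= m.
Proof. by move=> m0; rewrite /truncated_whiten; case: ifP => // _; rewrite /dot mul0mx mxE. Qed.

Lemma truncated_whiten_bounded a : 0 <= m ->
  bounded_measurable (fun u => truncated_whiten u 0 a).
Proof.
move=> m0; split.
  rewrite (_ : (fun u => _) =
      fun u => if dot (whiten u) (whiten u) <= m then whiten u 0 a else 0); last first.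
    by apply/funext => u; rewrite /truncated_whiten; case: ifP; rewrite // mxE.
  apply: measurable_fun_ifT; [|exact: measurable_whiten|exact: measurable_cst].
  apply: measurable_fun_ler; last exact: measurable_cst.
  under eq_fun do rewrite dotE; apply: measurable_sum => j.
  by apply: measurable_funM; exact: measurable_whiten.
exists (1 + m) => u.
have : truncated_whiten u 0 a ^+ 2 <= m.
  apply: le_trans (truncated_whiten_le u m0); rewrite dotE (bigD1 a)//= expr2 lerDl.
  by apply: sumr_ge0 => j _; rewrite -expr2 sqr_ge0.
rewrite ler_norml => h; apply/andP; split; nra.
Qed.

End Whitening.

Section SampleCovariance.
Context {R : realType} {disp : measure_display} {T : measurableType disp}.
Variable P : probability T R.
Variables (n d : nat) (x : 'I_n -> {RV P >-> d.-tuple R}) (m : R).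

Let X := rows_mx x.
Let Sigma := mx_expectation P (fun w => gram (X w)).
Let V := invmx (sqrtmx Sigma).
Let phi := truncated_whiten V m.

Hypothesis n_gt0 : (0 < n)%N.
Hypothesis iddist : identically_distributed x.
Hypothesis intS : mx_integrable P (fun w => gram (X w)).
Hypothesis unitS : Sigma \in unitmx.
Hypothesis m_gt0 : 0 < m.
Hypothesis zm : forall i, {ae P, forall w,
  norm2 (V *m (row i (X w))^T) <= Num.sqrt m}.

Let Q := sqrtmx Sigma.

Lemma psdmx_Sigma : psdmx Sigma.
Proof. by apply: psdmx_expectation => // w; exact: psdmx_gram. Qed.

Let QQ : Q *m Q = Sigma := (sqrtmxP psdmx_Sigma).2.

Let sQ : Q^T = Q := (sqrtmxP psdmx_Sigma).1.1.

Let unitQ : Q \in unitmx.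
Proof. by have := unitS; rewrite -QQ unitmx_mul => /andP[]. Qed.

Let sV : V^T = V.
Proof. by rewrite /V trmx_inv sQ. Qed.

Lemma row_rows_mx i w : row i (X w) *m V = whiten V (x i w).
Proof. by congr (_ *m _); apply/rowP => j; rewrite !mxE. Qed.

Lemma ae_truncated_whiten :
  {ae P, forall w, forall i, phi (x i w) = row i (X w) *m V}.
Proof.
apply: filter_forall => i; apply: filterS (zm i) => w zw.
rewrite /phi /truncated_whiten row_rows_mx ifT//.
move: zw; rewrite /norm2 (ler_sqrt _ (ltW m_gt0)); congr (_ <= _).
rewrite dotE -row_rows_mx; apply: eq_bigr => j _.
have -> : (V *m (row i (X w))^T) j 0 = (row i (X w) *m V) 0 j.
  by rewrite -{1}sV -trmx_mul mxE.
by rewrite expr2.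
Qed.

Lemma whitened_gram w : V *m gram (X w) *m V =
  \sum_i n%:R^-1 *: ((row i (X w) *m V)^T *m (row i (X w) *m V)).
Proof. exact: gram_conj. Qed.

Lemma whitened_expectation : V *m Sigma *m V = 1%:M.
Proof. by rewrite -QQ mulmxA mulVmx// mul1mx mulmxV. Qed.

Let bphi a b : bounded_measurable (fun u => phi u 0 a * phi u 0 b).
Proof. by apply: bounded_measurableM; apply: truncated_whiten_bounded; exact: ltW. Qed.

(** Sigma only gives the average of the second moments of the whitened rows, namely V Sigma V = I;
    identical distribution makes every summand equal to that average. Truncation changes the
    integrands only on a null set. *)
Lemma isotropic_truncated i a b :
  Ex P (fun w => phi (x i w) 0 a * phi (x i w) 0 b) = (a == b)%:R.
Proof.
have bphix j : bounded_measurable (fun w => phi (x j w) 0 a * phi (x j w) 0 b).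
  by apply: (bounded_measurable_comp _ (bphi a b)); exact: measurable_funPT.
have n0 : n%:R != 0 :> R by rewrite pnatr_eq0 -lt0n.
have [intVG EVG] := mx_expectation_mull V intS.
have intVGV : mx_integrable P (fun w => V *m gram (X w) *m V).
  have intT : mx_integrable P (fun w => (V *m gram (X w))^T).
    by move=> a' b'; have := intVG b' a'; congr (P.-integrable setT _);
      apply/funext => w /=; rewrite [in RHS]mxE.
  have [h _] := mx_expectation_mull V intT.
  move=> a' b'; have := h b' a'; congr (P.-integrable setT _).
  by apply/funext => w /=; rewrite -{1}sV -trmx_mul mxE.
transitivity ((V *m Sigma *m V) a b); last by rewrite whitened_expectation mxE.
rewrite -EVG -mx_expectation_mulr// (mx_expectationE P (fun w => V *m gram (X w) *m V)).
transitivity (Ex P (fun w => \sum_j n%:R^-1 * (phi (x j w) 0 a * phi (x j w) 0 b))).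
  rewrite Ex_sum => [|j _]; last exact: bounded_measurableZ.
  under eq_bigr do rewrite ExZ//
    (Ex_identically_distributed _ i iddist (bphi a b)).
  by rewrite sumr_const -[_ *+ #|_|]mulr_natl card_ord mulrA divff// mul1r.
congr fine; apply: ae_eq_integral => //.
- apply/measurable_EFinP.
  by apply: (bounded_measurable_sum _ (fun j _ => bounded_measurableZ _ (bphix j))).1.
- by have /integrableP[] := intVGV a b.
apply: filterS ae_truncated_whiten => w phiw _; congr (_%:E).
rewrite whitened_gram summxE; apply: eq_bigr => j _.
by rewrite mxE [in RHS]mxE big_ord1 -phiw !mxE.
Qed.

(** The trace of the isotropy relation gives d = E |z_i|^2. This is the source of m >= 1. *)
Lemma dimension_le : d%:R <= m.
Proof.
pose i := Ordinal n_gt0.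
have bdot a : bounded_measurable (fun w => phi (x i w) 0 a * phi (x i w) 0 a).
  by apply: (bounded_measurable_comp _ (bphi a a)); exact: measurable_funPT.
have -> : d%:R = Ex P (fun w => \sum_a phi (x i w) 0 a * phi (x i w) 0 a).
  rewrite Ex_sum//; under eq_bigr do rewrite isotropic_truncated eqxx.
  by rewrite sumr_const card_ord.
rewrite -(Ex_cst P m); apply: Ex_le.
- exact: bounded_measurable_sum.
- exact: bounded_measurable_cst.
- by move=> w; rewrite -dotE; apply: truncated_whiten_le; exact: ltW.
Qed.

(** Evaluation at [u *m Q] undoes the whitening: the operator norm bound on S becomes a bound on the
    forms of [gram (X w)] and Sigma relative to [quad Sigma u]. *)
Lemma eigval_gram_close w (delta : R) k : 0 <= delta ->
  (forall i, phi (x i w) = row i (X w) *m V) ->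
  \tr (centered_sum x phi w ^+ k.*2.+2) <= delta ^+ k.*2.+2 ->
  forall i, `|eigval (gram (X w)) i - eigval Sigma i| <= eigval Sigma i * delta.
Proof.
move=> d0 phiw trle i.
apply: eigval_relative_le => //; [exact: psdmx_Sigma|exact: psdmx_gram|move=> u].
have SE : centered_sum x phi w = V *m gram (X w) *m V - 1%:M.
  rewrite whitened_gram /centered_sum sumrB sumr_const -[_ *+ #|_|]scaler_nat card_ord.
  rewrite scalerA divff ?pnatr_eq0 -?lt0n// scale1r; congr (_ - _).
  by apply: eq_bigr => j _; rewrite phiw.
have := quad_le_of_trace (centered_sum_sym x phi w) d0 trle (u *m Q).
have quV (A : 'M[R]_d) : quad (V *m A *m V) (u *m Q) = quad A u.
  by rewrite -{2}sV quad_conj -mulmxA mulmxV// mulmx1.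
by rewrite SE quadB quV -whitened_expectation quV -quad1 -whitened_expectation quV.
Qed.

Lemma measurable_eigval_gram (i : 'I_d) :
  measurable_fun setT (fun w => eigval (gram (X w)) i).
Proof.
apply: measurable_eigval => [w|a b]; first by have [] := psdmx_gram (X w).
by apply/measurable_EFinP; have /integrableP[] := intS a b.
Qed.

Lemma measurable_eigval_close (r : 'I_d -> R) :
  measurable [set w | forall i, `|eigval (gram (X w)) i - eigval Sigma i| <= r i].
Proof.
rewrite (_ : mkset _ = \bigcap_(i in [set: 'I_d])
    [set w | `|eigval (gram (X w)) i - eigval Sigma i| <= r i]); last first.
  by apply/seteqP; split=> w h i; [move=> _; exact: h|exact: (h i I)].
apply: fin_bigcap_measurable => // i _.
rewrite -[X in measurable X]setTI; apply: measurable_fun_le => //.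
by apply: measurableT_comp => //; apply: measurable_funB => //; exact: measurable_eigval_gram.
Qed.

Lemma eigval_gram_tail (delta : R) k : mutually_independent x -> (0 < d)%N -> 0 < delta ->
  10 * (k.*2.+1%:R * (m / n%:R)) <= delta -> 20 * (k.*2.+1%:R * (m / n%:R)) <= delta ^+ 2 ->
  ((1 - d%:R * 2^-1 ^+ k.*2.+2)%R%:E <=
   P [set w | forall i,
     (`|eigval (gram (X w)) i - eigval Sigma i| <= eigval Sigma i * delta)%R])%E.
Proof.
move=> indep d0 delta0 kd kd2; set good := mkset _.
have m1 : 1 <= m by apply: le_trans dimension_le; rewrite ler1n.
have tail := centered_sum_tail indep n_gt0 m1
  (fun a => truncated_whiten_bounded V a (ltW m_gt0))
  (fun u => truncated_whiten_le V u (ltW m_gt0)) isotropic_truncated delta0 kd kd2.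
set bad := mkset _ in tail.
have btr := bounded_tr_centered_sum x
  (fun a => truncated_whiten_bounded V a (ltW m_gt0)) k.*2.+2.
have mbad : measurable bad.
  rewrite (_ : bad = setT `&` (fun w => \tr (centered_sum x phi w ^+ k.*2.+2))
      @^-1` `]delta ^+ k.*2.+2, +oo[).
    by apply: btr.1 => //; exact: measurable_itv.
  by apply/seteqP; split=> w; rewrite /bad /= in_itv/= andbT// => -[].
have [N [mN N0 subN]] := ae_truncated_whiten.
have mbN : measurable (bad `|` N) by exact: measurableU.
apply: (@le_trans _ _ (P (~` (bad `|` N)))).
  rewrite probability_setC// measureU0//.
  rewrite EFinB; apply: leeB => //.
(* Monotonicity is applied to measurable sets, which is why the eigenvalues had to be shown
   measurable. *)
apply: le_measure; rewrite ?inE; [exact: measurableC|exact: measurable_eigval_close|].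
move=> w /= /not_orP[wbad wN] i.
apply: (eigval_gram_close (k := k)); first exact: ltW.
  by apply: contrapT => h; apply: wN; exact: subN.
by rewrite leNgt; apply/negP.
Qed.

End SampleCovariance.

(** * Choice of the moment order *)

Theorem theorem9 (R : realType) :
  exists c : R, 0 < c /\
  forall (n d : nat) (disp : measure_display) (T : measurableType disp)
    (P : probability T R) (x : 'I_n -> {RV P >-> d.-tuple R}) (m t : R),
  let X := rows_mx x in
  let Sigma_hat := fun w => gram (X w) in
  let Sigma := mx_expectation P Sigma_hat in
  let z := fun i w => invmx (sqrtmx Sigma) *m (row i (X w))^T in
  let eps := t * Num.sqrt (m / n%:R) in
  let good := [set w | forall i : 'I_d,
    `|eigval (Sigma_hat w) i - eigval Sigma i|
      <= eigval Sigma i * Num.max eps (eps ^+ 2)] in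
  (d <= n)%N ->
  mutually_independent x ->
  identically_distributed x ->
  mx_integrable P Sigma_hat ->
  Sigma \in unitmx ->
  0 < m ->
  (forall i, {ae P, forall w, norm2 (z i w) <= Num.sqrt m}) ->
  0 <= t ->
  ((1 - 2 * d%:R * expR (- (c * t ^+ 2)))%R%:E <= P good)%E.
Proof.
exists 128^-1; split=> [|n d disp T P x m t X Sigma_hat Sigma z eps good dn indep idd intS
  unitS m0 zm t0]; first by rewrite invr_gt0.
have [d0|d_gt0] := posnP d.
  have -> : P good = 1%E.
    rewrite (_ : good = setT); first exact: probability_setT.
    by apply/seteqP; split=> // w _ i; have := ltn_ord i; rewrite {2}d0.
  have -> : d%:R = 0 :> R by rewrite d0.
  by rewrite lee_fin mulr0 mul0r subr0.
have n_gt0 : (0 < n)%N by exact: leq_trans dn.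
have d1 : 1 <= d%:R :> R by rewrite ler1n.
(* Below 64, exp(-t^2/128) >= 1 - t^2/128 >= 1/2, and the claimed lower bound is at most 1 - d <=
   0. *)
have [small|large] := ltP (t ^+ 2) 64.
  apply: (@le_trans _ _ 0%E); last exact: measure_ge0.
  have := expR_ge1Dx (- (128^-1 * t ^+ 2)); set e := expR _ => he.
  have : 2^-1 <= e by lra.
  by rewrite lee_fin; nra.
(* The moment order is 2p with p = k + 1; since t^2 >= 64, the integer part is at least 1 and the
   predecessor is genuine. *)
pose k := (Num.trunc (64^-1 * t ^+ 2)).-1.
have /andP[kt tk] : k.+1%:R <= 64^-1 * t ^+ 2 < k.+2%:R.
  have s1 : 1 <= 64^-1 * t ^+ 2 by lra.
  have kE : k.+1 = Num.trunc (64^-1 * t ^+ 2).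
    by rewrite /k prednK// truncn_gt0.
  by rewrite kE; apply: truncn_itv; lra.
pose mu := m / n%:R.
have mu0 : 0 < mu by rewrite divr_gt0// ltr0n.
have t_gt0 : 0 < t.
  by rewrite lt_neqAle t0 andbT; apply: contraTneq large => <-; rewrite expr0n/= -ltNge.
have eps0 : 0 < eps by rewrite /eps mulr_gt0// sqrtr_gt0.
have eps2 : eps ^+ 2 = t ^+ 2 * mu by rewrite /eps exprMn sqr_sqrtr// ltW.
pose delta := Num.max eps (eps ^+ 2).
have delta1 : eps <= delta by rewrite le_max lexx.
have delta2 : eps ^+ 2 <= delta by rewrite le_max lexx orbT.
have delta0 : 0 < delta by exact: lt_le_trans delta1.
(* 20 (2k + 1) mu <= 40 (k + 1) mu <= (40/64) t^2 mu. *)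
have kmu : 20 * (k.*2.+1%:R * mu) <= eps ^+ 2.
  have : k.*2.+1%:R <= 2 * k.+1%:R :> R by rewrite -natrM ler_nat mul2n doubleS.
  rewrite eps2; move: kt (ler0n R k.+1); nra.
have kmu0 : 0 <= k.*2.+1%:R * mu by rewrite mulr_ge0// ltW.
have delta3 : eps ^+ 2 <= delta ^+ 2 by rewrite lerXn2r// nnegrE ltW.
have k1 : 10 * (k.*2.+1%:R * mu) <= delta by apply: le_trans delta2; lra.
have k2 : 20 * (k.*2.+1%:R * mu) <= delta ^+ 2 by apply: le_trans delta3.
apply: le_trans (eigval_gram_tail n_gt0 idd intS unitS m0 zm indep d_gt0 delta0 k1 k2).
rewrite lee_fin lerD2l lerN2 (mulrC 2) -mulrA ler_wpM2l//.
by apply: half_pow_le_expR; lra.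
Qed.
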